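(* Let $f(z)=\sum_{n=1}^{\infty}A(n)q^n$ be a newform of even weight, with trivial Nebentypus, having complex multiplication by $\mathbb{Q}(\sqrt{-3})$, and whose level is of the form $3^s$ with $s\ge 2$. Then for every positive integer $n$ we have $$A(n)=0 \quad\text{if and only if}\quad b^*(n)=0.$$ More precisely, $A(n)=b^*(n)=0$ for those positive integers $n$ for which $\mathrm{ord}_p(n)$ is odd for some prime $p\equiv 2\pmod 3$.
   Context: Here $q:=e^{2\pi i z}$ with $z$ in the upper half-plane, and $\sum A(n)q^n$ is the Fourier expansion of $f$ at infinity. Newforms are in the sense of Atkin–Lehner, normalized so that $A(1)=1$. The notation $\mathrm{ord}_p(n)$ means the exponent of $p$ in the factorization of $n$. A newform of weight $k$ has complex multiplication by an imaginary quadratic field $K$ (with ring of integers $\mathcal{O}_K$) if it is of the form $\sum_{\mathfrak a}\phi(\mathfrak a)q^{N(\mathfrak a)}$. The sum is over integral ideals $\mathfrak a$ of $\mathcal{O}_K$ prime to a nontrivial ideal $\Lambda$, $N(\mathfrak a)$ is the norm of $\mathfrak a$, and $\phi: I(\Lambda)\to\mathbb{C}^\times$ is a homomorphism on the group $I(\Lambda)$ of fractional ideals prime to $\Lambda$ satisfying $\phi(\alpha\mathcal{O}_K)=\alpha^{k-1}$ for every $\alpha\in K^\times$ with $\alpha\equiv 1\pmod{\Lambda}$. The integers $b(n)$, $n\ge 0$ (the number of 3-core partitions of $n$), are defined by $$\sum_{n=0}^\infty b(n)x^n=\prod_{n=1}^\infty\frac{(1-x^{3n})^3}{1-x^n}.$$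 The integers $b^*(n)$, $n\ge 1$, are defined by $$\sum_{n=1}^{\infty}b^*(n)q^n:=\sum_{n=0}^\infty b(n)q^{3n+1},$$ that is, $b^*(3n+1)=b(n)$ for $n\ge 0$ and $b^*(m)=0$ if $m\not\equiv 1\pmod 3$. Equivalently, $\sum_{n\ge1} b^*(n)q^n=\eta(9z)^3/\eta(3z)$ with $\eta(z)=q^{1/24}\prod_{n\ge1}(1-q^n)$. *)

(* Defs.v *)
From HB Require Import structures.
From mathcomp Require Import all_boot all_order all_algebra.
From mathcomp Require Import all_classical all_reals all_analysis.
From mathcomp Require Import complex.

Set Implicit Arguments.
Unset Strict Implicit.
Unset Printing Implicit Defensive.

Import Order.TTheory GRing.Theory Num.Theory numFieldNormedType.Exports.
Local Open Scope classical_set_scope.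
Local Open Scope ring_scope.

(** * Modular forms on Gamma0(N) with trivial Nebentypus *)

Section ModularForms.
Variable R : realType.
Local Notation C := (R[i]).

Definition upper_half_plane : set C := [set z | 0 < complex.Im z].

Definition cexp (z : C) : C :=
  (expR (complex.Re z))%:C%C
    * (cos (complex.Im z) +i* sin (complex.Im z))%C.

Definition SL2Z : set 'M[int]_2 := [set g | \det g = 1].

Definition Gamma0 (N : nat) : set 'M[int]_2 :=
  [set g | SL2Z g /\ (N%:Z %| g 1%R 0%R)%Z].

Definition mobius (g : 'M[int]_2) (z : C) : C :=
  ((g 0 0)%:~R * z + (g 0 1)%:~R) / ((g 1 0)%:~R * z + (g 1 1)%:~R).

Definition slash (k : nat) (g : 'M[int]_2) (f : C -> C) (z : C) : C :=
  ((g 1 0)%:~R * z + (g 1 1)%:~R) ^- k * f (mobius g z).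

(* [f z] is the sum of [a n * exp (2 pi i n z / h)] over [n >= 1] for all [z]
   in the upper half-plane; the value [a 0] is irrelevant.  The topology of
   [C] is that of the regular module [C^o]. *)
Definition cusp_expansion (h : nat) (a : nat -> C) (f : C -> C) : Prop :=
  forall z, upper_half_plane z ->
    (fun m => \sum_(1 <= n < m)
       a n * cexp (2 * (pi : R)%:C%C * 'i%C * n%:R * z / h%:R) : C^o) @ \oo
      --> (f z : C^o).

Definition is_cusp_form (N k : nat) (f : C -> C) : Prop :=
  [/\ forall z, upper_half_plane z -> derivable (f : C^o -> C^o) z 1,
      forall g, Gamma0 N g ->
        forall z, upper_half_plane z -> slash k g f z = f z
    & forall g, SL2Z g ->
        exists h a, (0 < h)%N /\ cusp_expansion h a (slash k g f)].

(* The standard fundamental domain of SL2(Z), in the coordinates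
   [w = (x, y)] of the point [x + i y]. *)
Definition fundamental_domain : set (R * R) :=
  [set w | [/\ `|w.1| <= 2^-1, 0 < w.2 & 1 <= w.1 ^+ 2 + w.2 ^+ 2]].

Definition petersson_integrand (k : nat) (f1 f2 : C -> C) (w : R * R) : C :=
  f1 (w.1 +i* w.2)%C * (f2 (w.1 +i* w.2)%C)^*%C
    * (w.2 ^+ k / w.2 ^+ 2)%:C%C.

Definition petersson_integral (k : nat) (f1 f2 : C -> C) : C :=
  (Rintegral (lebesgue_measure \x lebesgue_measure)%E fundamental_domain
     (fun w => complex.Re (petersson_integrand k f1 f2 w))
   +i* Rintegral (lebesgue_measure \x lebesgue_measure)%E fundamental_domain
     (fun w => complex.Im (petersson_integrand k f1 f2 w)))%C.

(* [s] lists exactly one element of each coset [Gamma0 N * g], [g] in SL2(Z). *)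
Definition is_coset_reps (N : nat) (s : seq 'M[int]_2) : Prop :=
  [/\ uniq s, forall g, g \in s -> SL2Z g
    & forall g, SL2Z g ->
        exists! r, r \in s /\ exists2 c, Gamma0 N c & g = c *m r].

(* The Petersson product over [Gamma0 N], not divided by the index.  The union
   of the translates of [fundamental_domain] by coset representatives is a
   fundamental domain for [Gamma0 N], and the sum does not depend on them. *)
Definition petersson (N k : nat) (f1 f2 : C -> C) : C :=
  \sum_(g <- xget [::] (is_coset_reps N))
    petersson_integral k (slash k g f1) (slash k g f2).

(* Orthogonality to the generators [h (d z)] of the space of oldforms. *)
Definition is_new (N k : nat) (f : C -> C) : Prop :=
  forall (M d : nat) (h : C -> C),
    (M * d %| N)%N -> (M < N)%N -> is_cusp_form M k h ->
    petersson N k f (fun z => h (d%:R * z)) = 0.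

(* The operator T_p for a prime [p] not dividing the level. *)
Definition hecke (k p : nat) (f : C -> C) (z : C) : C :=
  p%:R ^+ k.-1 * f (p%:R * z)
    + p%:R^-1 * \sum_(j < p) f ((z + j%:R) / p%:R).

(* Following Atkin and Lehner, a newform is required to be an eigenform of the
   T_p with [p] prime to the level; that it is then an eigenform of the U_p
   with [p %| N] is a theorem of theirs. *)
Definition is_newform (N k : nat) (f : C -> C) (A : nat -> C) : Prop :=
  [/\ is_cusp_form N k f,
      is_new N k f,
      forall p, prime p -> ~~ (p %| N)%N ->
        exists lam : C,
          forall z, upper_half_plane z -> hecke k p f z = lam * f z,
      cusp_expansion 1 A f
    & A 1%N = 1].

End ModularForms.

(** * Complex multiplication by a number field embedded in C *)

Section ComplexMultiplication.
Variable R : realType.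
Local Notation C := (R[i]).

(* The field Q(sqrt(-D)) as a subfield of C. *)
Definition imag_quad_field (D : nat) : set C :=
  [set x | exists a b : rat,
     x = ratr a + ratr b * (0 +i* Num.sqrt (D%:R : R))%C].

Section Ideals.
Variable K : set C.

Definition ring_of_integers : set C :=
  [set x | K x /\ integralOver (intr : int -> C) x].

Definition is_fractional_ideal (I : set C) : Prop :=
  [/\ I `<=` K,
      forall x y, I x -> I y -> I (x + y),
      forall c x, ring_of_integers c -> I x -> I (c * x),
      exists2 x, I x & x != 0
    & exists d, [/\ ring_of_integers d, d != 0
        & forall x, I x -> ring_of_integers (d * x)]].

Definition is_integral_ideal (I : set C) : Prop :=
  is_fractional_ideal I /\ I `<=` ring_of_integers.

Definition ideal_mul (I J : set C) : set C :=
  [set x | exists (n : nat) (u v : 'I_n -> C),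
     (forall i, I (u i) /\ J (v i)) /\ x = \sum_(i < n) u i * v i].

Definition ideal_add (I J : set C) : set C :=
  [set x | exists u v, [/\ I u, J v & x = u + v]].

Definition principal_ideal (c : C) : set C :=
  [set c * x | x in ring_of_integers].

Definition coprime_ideals (I J : set C) : Prop :=
  ideal_add I J = ring_of_integers.

(* [#|O_K / I| = n] *)
Definition has_ideal_norm (I : set C) (n : nat) : Prop :=
  ([set [set x + y | y in I] | x in ring_of_integers] #= `I_n)%card.

(* The group I(L): the fractional ideals that are quotients of two integral
   ideals prime to [L]. *)
Definition ideals_prime_to (L : set C) : set (set C) :=
  [set I | is_fractional_ideal I /\
     exists J1 J2, [/\ is_integral_ideal J1, coprime_ideals J1 L,
       is_integral_ideal J2, coprime_ideals J2 L & ideal_mul I J2 = J1]].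

(* Multiplicative congruence [c = 1 mod^* L] for [c] in K^*. *)
Definition congr1_mod (L : set C) (c : C) : Prop :=
  exists u v, [/\ ring_of_integers u, ring_of_integers v, v != 0,
    coprime_ideals (principal_ideal v) L & L (u - v) /\ c = u / v].

Definition is_hecke_character (k : nat) (L : set C) (phi : set C -> C) :=
  [/\ forall I, ideals_prime_to L I -> phi I != 0,
      forall I J, ideals_prime_to L I -> ideals_prime_to L J ->
        phi (ideal_mul I J) = phi I * phi J
    & forall c, K c -> c != 0 -> congr1_mod L c ->
        phi (principal_ideal c) = c ^+ k.-1].

(* The sum ranges over the finitely many integral ideals of norm [n] prime to
   [L]. *)
Definition has_CM (k : nat) (A : nat -> C) : Prop :=
  exists (L : set C) (phi : set C -> C),
    [/\ is_integral_ideal L, is_hecke_character k L phi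
      & forall n, (0 < n)%N ->
          A n = \sum_(I \in [set I | [/\ is_integral_ideal I,
                   coprime_ideals I L & has_ideal_norm I n]]) phi I].

End Ideals.
End ComplexMultiplication.

(** * 3-core partitions *)

(* The coefficient of x^n in the product of (1 - x^(3i))^3 / (1 - x^i) over
   [i >= 1]: factors with [i > n] and terms x^(ij) of the geometric series
   1 / (1 - x^i) with [j > n] do not contribute to it. *)
Definition core3 (n : nat) : int :=
  (\prod_(1 <= i < n.+1)
     ((1 - 'X^(3 * i)) ^+ 3 * \sum_(0 <= j < n.+1) 'X^(i * j)) : {poly int})`_n.

Definition core3_star (n : nat) : int :=
  if (n %% 3 == 1)%N then core3 (n %/ 3) else 0.

(* Main.v *)
Require Import Defs.
From mathcomp Require Import all_boot all_order all_algebra.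
From mathcomp Require Import all_fingroup all_solvable all_field.
From mathcomp Require Import all_classical all_reals all_analysis.
From mathcomp Require Import complex.
From mathcomp Require Import zify ring lra.

Set Implicit Arguments.
Unset Strict Implicit.
Unset Printing Implicit Defensive.

Import Order.TTheory GRing.Theory Num.Theory numFieldNormedType.Exports.
Local Open Scope classical_set_scope.
Local Open Scope ring_scope.

(** Both [A n] and [core3_star n] vanish exactly when 3 divides [n] or [ord_p n]
    is odd for some prime [p = 2 mod 3].

    3-cores: expand both sides of [prod_(j < 6M) (1 + z q^j) =
    prod_(i < 3) prod_(j < 2M) (1 + z q^i q^(3j))] by Rothe's identity and compare
    the coefficients of [z^(3M)].  For large [M] this shows that the number of
    3-cores of [n] is the number of integers [(a, b)] with
    [3 (a^2 + a b + b^2) + a + 2 b = n], that is, with [3n + 1] the norm of the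
    Eisenstein integer [3a - (3b + 1) w].

    CM forms: Z[w] is principal, so the modulus is [(l)] and [A n] is the sum of a
    character [chi] over the ideals of norm [n].  The operators [T_p], [p <> 3],
    make [A] multiplicative away from 3 and determine [A(p^e)] from [A p].  If
    [p = 2 mod 3] there is no ideal of norm [p], so [A p = 0] and [A(p^2) <> 0].
    If [p = 1 mod 3] then [A(p^e) = (x^(e+1) - y^(e+1)) / (x - y)], with [x] and
    [y] the values of [chi] at the two primes above [p]; since a power of [chi] is
    a power of the generator, [x / y] is not a root of unity.  The relations for
    [A(p^2)] also show that [l] is prime to every [p <> 3].  As [k - 1] is odd,
    [l] is not a unit, so [sqrt (-3)] divides [l] and [A n = 0] when 3 divides
    [n]. *)

(** * Gaussian binomials and the generating function of 3-cores *)

Section QBinomial.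
Variable R : comNzRingType.
Implicit Types (q z : R) (m k : nat).

(** The Gaussian binomial coefficient. The q-Pascal rule defines it over any commutative ring,
    without division by the factors [1 - q ^+ i]. *)
Fixpoint qbin q m k : R :=
  match m, k with
  | _, 0 => 1
  | 0, _.+1 => 0
  | m'.+1, k'.+1 => q ^+ k * qbin q m' k + qbin q m' k'
  end.

(** The q-Pochhammer symbol $(q; q)_k$. *)
Definition qpoch q k : R := \prod_(1 <= i < k.+1) (1 - q ^+ i).

Lemma qbin0 q m : qbin q m 0 = 1. Proof. by case: m. Qed.

Lemma qbinS q m k :
  qbin q m.+1 k.+1 = q ^+ k.+1 * qbin q m k.+1 + qbin q m k.
Proof. by []. Qed.

Lemma qbin_small q m k : (m < k)%N -> qbin q m k = 0.
Proof.
elim: m k => [|m IHm] [|k] // lt_mk.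
by rewrite qbinS !IHm ?mulr0 ?addr0 // ltnW.
Qed.

Lemma qpochS q k : qpoch q k.+1 = qpoch q k * (1 - q ^+ k.+1).
Proof. by rewrite /qpoch big_nat_recr. Qed.

Lemma qpoch0 q : qpoch q 0 = 1.
Proof. by rewrite /qpoch big_nil. Qed.

(** This is the quotient formula for Gaussian binomials with the denominators cleared. *)
Lemma qbin_qpoch q m k :
  (k <= m)%N -> qbin q m k * qpoch q k * qpoch q (m - k) = qpoch q m.
Proof.
elim: m k => [|m IHm] [|k]; rewrite ?subn0 ?qbin0 ?qpoch0 ?mulr1 ?mul1r //.
rewrite ltnS leq_eqVlt => /predU1P[->|lt_km].
  rewrite subSS subnn qpoch0 mulr1 qbinS qbin_small // mulr0 add0r.
  by rewrite !qpochS mulrA -[in RHS](IHm m) // subnn qpoch0 mulr1.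
have IH1 := IHm _ lt_km; have IH2 := IHm _ (ltnW lt_km).
have E : qpoch q (m - k) = qpoch q (m - k.+1) * (1 - q ^+ (m - k)).
  by rewrite -{1}(subnSK lt_km) qpochS subnSK.
rewrite subSS qbinS mulrDl mulrDl.
transitivity (q ^+ k.+1 * qpoch q m * (1 - q ^+ (m - k))
              + qpoch q m * (1 - q ^+ k.+1)).
  congr (_ + _); first by rewrite E -IH1; ring.
  by rewrite qpochS -IH2; ring.
have -> : qpoch q m.+1 = qpoch q m * (1 - q ^+ k.+1 * q ^+ (m - k)).
  by rewrite -exprD addSn subnKC ?(ltnW lt_km) // qpochS.
ring.
Qed.

(** Splitting off the factor [1 + z] leaves the product for [z * q]; the q-Pascal rule then matches
    the coefficients of each power of [z]. *)
Lemma rothe q z m :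
  \prod_(j < m) (1 + z * q ^+ j) =
  \sum_(k < m.+1) q ^+ 'C(k, 2) * qbin q m k * z ^+ k.
Proof.
elim: m z => [|m IHm] z.
  by rewrite big_ord0 big_ord_recl big_ord0 /= bin0n !expr0 !mulr1 addr0.
rewrite big_ord_recl expr0 mulr1.
under eq_bigr => i _ do rewrite lift0 exprS mulrA.
rewrite IHm mulrDl mul1r.
rewrite [RHS]big_ord_recl [X in X + _]big_ord_recl /= !qbin0 !expr0.
rewrite -addrA; congr (_ + _).
rewrite mulr_sumr [X in _ + X]big_ord_recr /=.
rewrite [X in _ = X]big_ord_recr /= addrA; congr (_ + _).
  rewrite -big_split /=; apply: eq_bigr => i _.
  rewrite /bump /= !add1n add0n binS bin1 exprD !exprMn !exprS.
  ring.
rewrite /bump /= !add1n add0n (@qbin_small _ m m.+1) // mulr0 add0r.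
rewrite binS bin1 exprD exprMn exprS; ring.
Qed.

End QBinomial.

Lemma qbin_morph (R S : comNzRingType) (g : {rmorphism R -> S}) q m k :
  qbin (g q) m k = g (qbin q m k).
Proof.
elim: m k => [|m IHm] [|k] //=; rewrite ?rmorph1 ?rmorph0 //.
by rewrite !IHm rmorphD rmorphM rmorphXn.
Qed.

(** * Polynomials modulo a power of the indeterminate *)

Section Truncation.
Variables (R : comNzRingType) (n : nat).
Implicit Types p a b c d : {poly R}.

(** Congruence modulo ['X^n.+1]; it replaces identities between power series by identities between
    polynomials. *)
Definition trunc_eq a b := forall i, (i <= n)%N -> a`_i = b`_i.

Lemma trunc_eqM a b c d :
  trunc_eq a b -> trunc_eq c d -> trunc_eq (a * c) (b * d).
Proof.
move=> ab cd i le_in; rewrite !coefM; apply: eq_bigr => j _.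
by rewrite ab ?cd ?(leq_trans (leq_subr _ _)) // (leq_trans _ le_in) // -ltnS.
Qed.

Lemma trunc_eq_trans a b c : trunc_eq a b -> trunc_eq b c -> trunc_eq a c.
Proof. by move=> ab bc i le_in; rewrite ab ?bc. Qed.

Lemma trunc_eq_sym a b : trunc_eq a b -> trunc_eq b a.
Proof. by move=> ab i le_in; rewrite ab. Qed.

(** A polynomial with constant term 1 is invertible as a power series. *)
Lemma trunc_eq_cancel p a b :
  p`_0 = 1 -> trunc_eq (p * a) (p * b) -> trunc_eq a b.
Proof.
move=> p0 pab; elim/ltn_ind => i IHi le_in.
have := pab i le_in; rewrite !coefM !big_ord_recl /= p0 !mul1r subn0.
rewrite (eq_bigr (fun j : 'I_i => p`_(bump 0 j) * b`_(i - bump 0 j))).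
  by move/addIr.
by move=> j _; have := ltn_ord j; rewrite /bump /= => lt_ji; rewrite IHi //;
  lia.
Qed.

Lemma trunc_eq_Xn k : (n < k)%N -> trunc_eq (1 - 'X^k) 1.
Proof.
move=> lt_nk i le_in; rewrite coefB coefXn.
by rewrite (ltn_eqF (leq_ltn_trans le_in lt_nk)) subr0.
Qed.

Lemma qpoch_coef0 k m : (0 < k)%N -> (qpoch ('X^k : {poly R}) m)`_0 = 1.
Proof.
move=> k_gt0; rewrite /qpoch; elim: m => [|m IHm];
  first by rewrite big_nil coef1.
rewrite big_nat_recr //= coefM big_ord1 IHm mul1r coefB coef1 eqxx -exprM
  coefXn.
by rewrite ltn_eqF ?muln_gt0 ?k_gt0 //= subr0.
Qed.

Lemma qpoch_trunc_eq k m : (0 < k)%N -> (n <= m)%N ->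
  trunc_eq (qpoch ('X^k : {poly R}) m) (qpoch 'X^k n).
Proof.
move=> k_gt0 /subnKC <-; elim: (m - n)%N => [|j IHj]; first by rewrite addn0.
rewrite addnS qpochS -[X in trunc_eq _ X]mulr1; apply: trunc_eqM => //.
rewrite -exprM; apply: trunc_eq_Xn.
by rewrite -addnS (leq_trans _ (leq_pmull _ k_gt0)) // addnS ltnS leq_addr.
Qed.

(** Since [l], [m - l] and [m] are all at least [n], the three Pochhammer symbols in [qbin_qpoch]
    agree with [qpoch 'X^k n] up to degree [n], and one of them cancels. *)
Lemma qbin_trunc_eq k m l : (0 < k)%N -> (n <= l)%N -> (n + l <= m)%N ->
  trunc_eq (qbin ('X^k : {poly R}) m l * qpoch 'X^k n) 1.
Proof.
move=> k_gt0 le_nl le_lm.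
have le_nm : (n <= m)%N by rewrite (leq_trans _ le_lm) ?leq_addr.
have le_nml : (n <= m - l)%N by lia.
apply: (@trunc_eq_cancel (qpoch 'X^k n)); rewrite ?qpoch_coef0 // mulr1.
apply: trunc_eq_trans (qpoch_trunc_eq k_gt0 le_nm).
rewrite -(@qbin_qpoch _ _ m l); last by lia.
rewrite mulrC -!mulrA; do 2?apply: trunc_eqM => //;
  by apply: trunc_eq_sym; apply: qpoch_trunc_eq.
Qed.

End Truncation.

(** * The number of 3-cores as a number of representations *)

Lemma prod_ord_mod3 (R : comNzRingType) m (g : nat -> R) :
  \prod_(j < 3 * m) g j =
  \prod_(j < m) g (3 * j)%N * \prod_(j < m) g (3 * j).+1
    * \prod_(j < m) g (3 * j).+2.
Proof.
elim: m => [|m IHm]; first by rewrite !big_ord0 !mulr1.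
by rewrite mulnS !big_ord_recr /= IHm; ring.
Qed.

(* Split [prod_(j < 6M) (1 + z q^j)] according to [j] modulo 3, expand each
   factor by Rothe's identity and compare the coefficients of [z^(3M)]. *)
Lemma qbin_triple (M : nat) (q : {poly int}) :
  q ^+ 'C(3 * M, 2) * qbin q (6 * M) (3 * M) =
  \sum_(j < (3 * M).+1) \sum_(i < j.+1)
    q ^+ (3 * ('C(i, 2) + 'C(j - i, 2) + 'C(3 * M - j, 2))
          + (j - i) + 2 * (3 * M - j))
    * (qbin (q ^+ 3) (2 * M) i * qbin (q ^+ 3) (2 * M) (j - i)
       * qbin (q ^+ 3) (2 * M) (3 * M - j)).
Proof.
(* The coefficient of [z^k] in the product of the [1 + z q^l r^j] over [j < m]. The outer
   indeterminate of [{poly {poly int}}] plays the role of [z]. *)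
pose c r m l (k : nat) := r ^+ 'C(k, 2) * qbin r m k * (q ^+ l) ^+ k.
have rotheP r m l : \prod_(j < m) (1 + 'X * (q ^+ l)%:P * r%:P ^+ j) =
    \poly_(k < m.+1) c r m l k.
  rewrite rothe poly_def; apply: eq_bigr => k _.
  rewrite (qbin_morph polyC) exprMn /c -mul_polyC !polyCM !polyC_exp; ring.
have coef_c r m l k : (\poly_(k < m.+1) c r m l k)`_k = c r m l k.
  rewrite coef_poly; case: ltnP => // lt_mk.
  by rewrite /c qbin_small // mulr0 mul0r.
have := rotheP q (6 * M)%N 0%N.
have -> : (6 * M = 3 * (2 * M))%N by rewrite mulnA.
rewrite (prod_ord_mod3 (2 * M) (fun j => 1 + 'X * (q ^+ 0)%:P * q%:P ^+ j)).
rewrite (eq_bigr (fun j : 'I__ => 1 + 'X * (q ^+ 0)%:P * (q ^+ 3)%:P ^+ j));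
  last by move=> j _; rewrite exprM -polyC_exp.
rewrite rotheP.
rewrite (eq_bigr (fun j : 'I__ => 1 + 'X * (q ^+ 1)%:P * (q ^+ 3)%:P ^+ j));
  last by move=> j _; rewrite exprS exprM -polyC_exp expr0 expr1 mulr1 mulrA.
rewrite rotheP.
rewrite (eq_bigr (fun j : 'I__ => 1 + 'X * (q ^+ 2)%:P * (q ^+ 3)%:P ^+ j));
  last first.
  move=> j _; rewrite !exprS exprM -polyC_exp expr0 !mulr1 polyCM; ring.
rewrite rotheP => /polyP/(_ (3 * M)%N).
rewrite coef_c coefM [in RHS]/c [in RHS]expr0 [in RHS]expr1n mulr1 => <-.
apply: eq_bigr => j _; rewrite coef_c coefM big_distrl /=.
apply: eq_bigr => i _; rewrite !coef_c /c.
rewrite expr0 expr1n -!exprM !mulnDr mul1n !exprD; ring.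
Qed.

Lemma bin2_int (k : nat) : 2 * ('C(k, 2))%:Z = k%:Z * (k%:Z - 1).
Proof. by elim: k => // k IHk; rewrite binS bin1 PoszD mulrDr IHk; lia. Qed.

(** The exponent in [qbin_triple] for lower indices of sum [3M], expressed through their deviations
    from [M]. *)
Lemma core_exponent (M : nat) (a b : int) (i j k : nat) :
  i%:Z = M%:Z - a - b -> j%:Z = M%:Z + a -> k%:Z = M%:Z + b ->
  (3 * ('C(i, 2) + 'C(j, 2) + 'C(k, 2)) + j + 2 * k)%N%:Z =
  ('C(3 * M, 2))%:Z + (3 * (a ^+ 2 + a * b + b ^+ 2) + a + 2 * b).
Proof.
move=> Ei Ej Ek; have := bin2_int i; have := bin2_int j; have := bin2_int k.
have := bin2_int (3 * M).
rewrite Ei Ej Ek => H0 H1 H2 H3; lia.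
Qed.

(** With [x = 3a] and [y = 3b + 1] the hypothesis reads [x^2 + x y + y^2 <= 3n + 1], and
    [4 (x^2 + x y + y^2)] is a square plus any one of [3 x^2], [3 y^2], [3 (x + y)^2]. *)
Lemma core_bound (n : nat) (a b : int) :
  3 * (a ^+ 2 + a * b + b ^+ 2) + a + 2 * b <= n%:Z ->
  [/\ `|a| <= n%:Z + 1, `|b| <= n%:Z + 1 & `|a + b| <= n%:Z + 1].
Proof.
move=> le_n.
have Ha : 27 * a ^+ 2 <= 12 * n%:Z + 4.
  have := sqr_ge0 (2 * (3 * b + 1) + 3 * a); lia.
have Hb : 3 * (3 * b + 1) ^+ 2 <= 12 * n%:Z + 4.
  have := sqr_ge0 (2 * (3 * a) + (3 * b + 1)); lia.
have Hab : 3 * (3 * (a + b) + 1) ^+ 2 <= 12 * n%:Z + 4.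
  have := sqr_ge0 (3 * a - (3 * b + 1)); lia.
split; nia.
Qed.

(* The degree of the monomial exceeds ['C(3M, 2)] by the value at
   [(j - i - M, 2M - j)] of the quadratic polynomial in [core_bound].  If this
   value is at most [n], then the three lower indices are so close to [M] that
   each Gaussian binomial agrees with [1 / qpoch Q n] up to degree [n]. *)
Lemma core3_term (n i j : nat) (M := (2 * n).+1) (Q := 'X^3 : {poly int}) :
  (i <= j <= 3 * M)%N ->
  ('X^(3 * ('C(i, 2) + 'C(j - i, 2) + 'C(3 * M - j, 2))
          + (j - i) + 2 * (3 * M - j))
    * (qbin Q (2 * M) i * qbin Q (2 * M) (j - i)
       * qbin Q (2 * M) (3 * M - j)) * qpoch Q n ^+ 3)`_('C(3 * M, 2) + n)
  = (3 * ('C(i, 2) + 'C(j - i, 2) + 'C(3 * M - j, 2))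
          + (j - i) + 2 * (3 * M - j) == 'C(3 * M, 2) + n)%N%:R.
Proof.
move=> /andP[le_ij le_jM].
pose a : int := (j - i)%N%:Z - M%:Z; pose b : int := (3 * M - j)%N%:Z - M%:Z.
have := @core_exponent M a b i (j - i) (3 * M - j).
set E := (_ + _ * (3 * M - j))%N => EE.
have {EE}: E%:Z =
    ('C(3 * M, 2))%:Z + (3 * (a ^+ 2 + a * b + b ^+ 2) + a + 2 * b).
  by apply: EE; rewrite /a /b; lia.
move=> EE; rewrite -mulrA coefXnM; case: ltnP => [lt_E | le_E].
  by rewrite gtn_eqF.
(* The lower indices are [M - a - b], [M + a] and [M + b]. They lie between [M - n - 1 = n] and
   [M + n + 1 = 2M - n], as [qbin_trunc_eq] requires; hence the choice [M = 2n + 1]. *)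
have /core_bound[] : 3 * (a ^+ 2 + a * b + b ^+ 2) + a + 2 * b <= n%:Z by lia.
move=> Ha Hb Hab.
transitivity ((1 * 1 * 1 : {poly int})`_('C(3 * M, 2) + n - E)).
  have -> (u v w p : {poly int}) :
    u * v * w * p ^+ 3 = (u * p) * (v * p) * (w * p) by ring.
  apply: (@trunc_eqM _ n); last first.
  - suff : 0 <= 3 * (a ^+ 2 + a * b + b ^+ 2) + a + 2 * b by lia.
    have := sqr_ge0 (2 * (3 * b + 1) + 3 * a); have := sqr_ge0 a; lia.
  - apply: qbin_trunc_eq => //; lia.
  - by apply: trunc_eqM; apply: qbin_trunc_eq => //; lia.
by rewrite !mulr1 coef1 subn_eq0 eqn_leq le_E.
Qed.

(** Up to degree [n], the product of the truncated geometric series and the central Gaussian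
    binomial are both inverse to [qpoch 'X n]. *)
Lemma core3_qbin (n : nat) (M := (2 * n).+1) :
  core3 n = (qbin 'X (6 * M) (3 * M) * qpoch 'X^3 n ^+ 3)`_n.
Proof.
rewrite /core3 big_split /= prodrXl.
set G := \prod_(1 <= i < n.+1) \sum_(0 <= j < n.+1) _.
have GP : trunc_eq n (qpoch ('X^1) n * G) 1.
  rewrite /qpoch /G -big_split /=.
  rewrite big_seq; apply: (big_ind (fun p => trunc_eq n p 1)) => // [a b|i].
    by move=> a1 b1; rewrite -[1 in X in trunc_eq _ _ X]mulr1; apply: trunc_eqM.
  rewrite mem_index_iota => /andP[i_gt0 _].
  under eq_bigr do rewrite exprM.
  rewrite expr1 big_mkord -[X in X * _]opprB mulNr -subrX1 opprB -exprM.
  by apply: trunc_eq_Xn; rewrite leq_pmull.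
have -> : \prod_(1 <= i < n.+1) (1 - 'X^(3 * i)) = qpoch 'X^3 n :> {poly int}.
  by apply: eq_bigr => i _; rewrite exprM.
rewrite mulrC; apply: (@trunc_eqM _ n) => //.
apply: (@trunc_eq_cancel _ n (qpoch 'X^1 n)); rewrite ?qpoch_coef0 //.
apply: (trunc_eq_trans GP); apply: trunc_eq_sym.
rewrite mulrC; apply: (@qbin_trunc_eq _ n 1 (6 * M) (3 * M)) => //; lia.
Qed.

(** By [qbin_triple] and [core3_term], [core3 n] counts the index pairs whose exponent is
    ['C(3 * M, 2) + n]; [core_exponent] turns them into solutions [(a, b)]. *)
Lemma core3_neq0 (n : nat) :
  core3 n != 0 <->
  exists a b : int, 3 * (a ^+ 2 + a * b + b ^+ 2) + a + 2 * b = n%:Z.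
Proof.
pose M := (2 * n).+1.
pose E j i := (3 * ('C(i, 2) + 'C(j - i, 2) + 'C(3 * M - j, 2))
          + (j - i) + 2 * (3 * M - j))%N.
have -> : core3 n = \sum_(j < (3 * M).+1) \sum_(i < j.+1)
    ((E j i == 'C(3 * M, 2) + n)%N%:R).
  rewrite core3_qbin -/M.
  have -> (p : {poly int}) : p`_n = ('X^('C(3 * M, 2)) * p)`_('C(3 * M, 2) + n).
    by rewrite coefXnM ltnNge leq_addr addKn.
  rewrite mulrA qbin_triple mulr_suml coef_sum; apply: eq_bigr => j _.
  rewrite mulr_suml coef_sum; apply: eq_bigr => i _; apply: core3_term.
  by have := ltn_ord i; have := ltn_ord j; lia.
split=> [neq0|[a [b Eab]]].
  have [] := boolP [exists j : 'I_(3 * M).+1, exists i : 'I_j.+1,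
    E j i == ('C(3 * M, 2) + n)%N]; last first.
    move=> noE; case/eqP: neq0; apply: big1 => j _; apply: big1 => i _.
    case: eqP => // EE; case/negP: noE.
    by apply/existsP; exists j; apply/existsP; exists i; apply/eqP.
  case/existsP=> j /existsP[i /eqP EE].
  exists ((j - i)%N%:Z - M%:Z), ((3 * M - j)%N%:Z - M%:Z).
  have := @core_exponent M ((j - i)%N%:Z - M%:Z) ((3 * M - j)%N%:Z - M%:Z)
    i (j - i) (3 * M - j).
  rewrite -/(E j i) EE => H; have := ltn_ord i; have := ltn_ord j => Hj Hi.
  have {}H := H ltac:(lia) ltac:(lia) ltac:(lia).
  by move: H; rewrite PoszD => /addrI.
have /core_bound[Ha Hb Hab] : 3 * (a ^+ 2 + a * b + b ^+ 2) + a + 2 * b <= n%:Z.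
  by rewrite Eab.
(* The indices come from solving [a = j - i - M] and [b = 2M - j]; the bounds on [a], [b] and
   [a + b] keep them in range. *)
have lt_j : (absz (2 * M%:Z - b)%R < (3 * M).+1)%N by lia.
pose j : 'I_(3 * M).+1 := Ordinal lt_j.
have lt_i : (absz (M%:Z - a - b)%R < j.+1)%N by rewrite /j /=; lia.
pose i : 'I_j.+1 := Ordinal lt_i.
rewrite gt_eqF // (bigD1 j) //= (bigD1 i) //=.
have -> : E j i = ('C(3 * M, 2) + n)%N.
  have := @core_exponent M a b i (j - i) (3 * M - j).
  rewrite -/(E j i) Eab /i /j /=; lia.
by rewrite eqxx -addrA ltr_pwDl // addr_ge0 // sumr_ge0 // => *;
  rewrite ?sumr_ge0.
Qed.

(** * Integers represented by the norm form of Z[w] *)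

(** The norm of [a + b w], where [w] is a primitive cube root of unity. *)
Definition nm (a b : int) : int := a ^+ 2 - a * b + b ^+ 2.

Lemma nm_mul a b c d :
  nm (a * c - b * d) (a * d + b * c - b * d) = nm a b * nm c d.
Proof. rewrite /nm; ring. Qed.

Lemma nm_ge0 a b : 0 <= nm a b.
Proof. have := sqr_ge0 (2 * a - b); have := sqr_ge0 b; rewrite /nm; lia. Qed.

Lemma nm_eq0 a b : nm a b = 0 -> a = 0 /\ b = 0.
Proof.
have := sqr_ge0 (2 * a - b); have := sqr_ge0 (2 * b - a).
have := sqr_ge0 a; have := sqr_ge0 b; rewrite /nm => *.
by split; apply/eqP; rewrite -sqrf_eq0; lia.
Qed.

Lemma prime_dvdz_mul (p : nat) (a b : int) :
  prime p -> (p %| a * b)%Z = (p %| a)%Z || (p %| b)%Z.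
Proof. by move=> p_pr; rewrite !dvdzE abszM Euclid_dvdM. Qed.

Lemma prime_dvdz_exp (p n : nat) (a : int) :
  prime p -> (p %| a ^+ n)%Z = (p %| a)%Z && (0 < n)%N.
Proof. by move=> p_pr; rewrite !dvdzE abszX Euclid_dvdX. Qed.

(* Cubing is a bijection modulo [p]: if [p = 3m + 2] and [a^3 = -b^3] then
   [a = a^(3(2m+1)) = -b^(3(2m+1)) = -b] modulo [p], as [3(2m+1) = 2(p-1)+1]. *)
Lemma nm_inert (p : nat) (a b : int) : prime p -> (p %% 3 = 2)%N ->
  (p %| nm a b)%Z -> (p %| a)%Z && (p %| b)%Z.
Proof.
move=> p_pr p2 pab; have p_gt0 := prime_gt0 p_pr.
pose r (x : int) : 'F_p := x%:~R.
have rP x : (p %| x)%Z = (r x == 0).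
  rewrite /r; case: (intP x) => [|n|n]; rewrite ?dvdz0 ?mulr0z ?eqxx //.
    by rewrite dvdzE /= -(dvdn_pcharf (pchar_Fp p_pr)).
  by rewrite dvdzE /= mulrNz oppr_eq0 -(dvdn_pcharf (pchar_Fp p_pr)).
move: pab; rewrite !rP /r /nm => /eqP.
rewrite rmorphD rmorphB !rmorphXn (rmorphM _ a b) /=.
move: (a%:~R : 'F_p) (b%:~R : 'F_p) => x y xy0.
have fermat z : z ^+ p = z :> 'F_p.
  by rewrite -[in RHS](expf_card z) card_Fp.
have fermat2 z : z ^+ (3 * (2 * (p %/ 3)).+1) = z :> 'F_p.
  have [->|z_neq0] := eqVneq z 0; first by rewrite expr0n.
  apply: (mulfI z_neq0); rewrite -exprS.
  have -> : ((3 * (2 * (p %/ 3)).+1).+1 = p + p)%N by lia.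
  by rewrite exprD !fermat.
have cubes : x ^+ 3 = - y ^+ 3.
  have -> : x ^+ 3 = (x + y) * (x ^+ 2 - x * y + y ^+ 2) - y ^+ 3 by ring.
  by rewrite xy0 mulr0 sub0r.
have xNy : x = - y.
  rewrite -(fermat2 x) exprM cubes -{2}(fermat2 y) exprM.
  by rewrite -[LHS]/(_ ^+ _.+1) exprNn -signr_odd /= oddM /= mulN1r.
have : y ^+ 2 *+ 3 = 0 by rewrite -xy0 xNy; ring.
move/eqP; rewrite -mulr_natr mulf_eq0 expf_eq0 /=.
rewrite -(dvdn_pcharf (pchar_Fp p_pr)) dvdn_prime2 //.
case/orP=> [/eqP y0|/eqP p3]; last by exfalso; move: p2; rewrite p3.
by rewrite xNy y0 oppr0 eqxx.
Qed.

Lemma nat_sqrt n : exists r, (r * r <= n < r.+1 * r.+1)%N.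
Proof.
elim: n => [|n [r /andP[le_r lt_r]]]; first by exists 0%N.
by have [?|?] := leqP (r.+1 * r.+1) n.+1; [exists r.+1 | exists r]; nia.
Qed.

(* Thue's argument: if [x] is a primitive cube root of unity modulo [p], the
   pigeonhole principle gives a small nonzero solution of [a = x b] modulo [p],
   so that [nm a (- b)] is a small multiple of [p]. *)
Lemma nm_split (p : nat) : prime p -> (p %% 3 = 1)%N ->
  exists a b, nm a b = p%:Z.
Proof.
move=> p_pr p1; have p_gt0 := prime_gt0 p_pr.
have [x x2] : exists x : 'F_p, x ^+ 2 + x + 1 = 0.
  (* As 3 divides [p - 1], Cauchy's theorem provides a unit of order 3. *)
  have [] := @Cauchy _ 3 [set: {unit 'F_p}] isT.
    by rewrite card_finField_unit card_Fp //; lia.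
  move=> u _ ou; exists (val u).
  have u3 : (val u) ^+ 3 = 1.
    by rewrite -FinRing.val_unitX -ou expg_order FinRing.val_unit1.
  have u_neq1 : val u - 1 != 0.
    rewrite subr_eq0; apply/eqP => u1; have : u = 1%g by apply: val_inj.
    by move=> uE; move: ou; rewrite uE order1.
  apply: (mulfI u_neq1); rewrite mulr0.
  have -> (v : 'F_p) : (v - 1) * (v ^+ 2 + v + 1) = v ^+ 3 - 1 by ring.
  by rewrite u3 subrr.
have [r /andP[le_r lt_r]] := nat_sqrt p.
pose g (w : 'I_r.+1 * 'I_r.+1) : 'F_p := w.1%:R + x * w.2%:R.
have /injectivePn[w1 [w2 neq_w eq_g]] : ~~ injectiveb g.
  apply/injectiveP => /leq_card; rewrite (card_Fp p_pr) card_prod !card_ord;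
    lia.
pose a := w1.1%:Z - w2.1%:Z; pose b := w2.2%:Z - w1.2%:Z.
have b_le : `|b| <= r%:Z by have := ltn_ord w1.2; have := ltn_ord w2.2; lia.
have a_le : `|a| <= r%:Z by have := ltn_ord w1.1; have := ltn_ord w2.1; lia.
have axb : a%:~R = x * b%:~R :> 'F_p.
  rewrite /a /b !rmorphB /=; move: eq_g; rewrite /g => eq_g.
  rewrite mulrBr; apply/eqP; rewrite subr_eq addrAC eq_sym subr_eq addrC.
  by rewrite -!pmulrn; apply/eqP; rewrite [RHS]addrC -eq_g addrC.
have p_dvd : (p %| nm a (-b))%Z.
  have : (nm a (-b))%:~R = 0 :> 'F_p.
    rewrite /nm rmorphD rmorphB !rmorphXn (rmorphM _ a) /= rmorphN /=.
    rewrite axb -[RHS](mulr0 (b%:~R ^+ 2)) -x2; ring.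
  case: (nm a (-b)) (nm_ge0 a (-b)) => // n _ /eqP.
  by rewrite -(dvdn_pcharf (pchar_Fp p_pr)).
have nm_neq0 : nm a (-b) != 0.
  apply: contra neq_w => /eqP/nm_eq0[a0 b0].
  by apply/eqP; case: w1 w2 @a @b a0 b0 {eq_g b_le a_le axb p_dvd}
    => [u1 v1] [u2 v2] /= a0 b0; congr (_, _); apply: val_inj => /=; lia.
(* The norm is at most [3 r^2], and [r^2 < p] strictly because a prime is not a square. *)
have nm_lt : nm a (-b) < 3 * p%:Z.
  have : r%:Z * r%:Z < p%:Z.
    rewrite lt_neqAle -PoszM lez_nat le_r andbT eqz_nat.
    apply/eqP => Ep; have /primeP[p_gt1 /(_ r)] := p_pr.
    by rewrite -Ep dvdn_mulr // => /(_ isT)/orP[]/eqP; nia.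
  move: a_le b_le; move: (a) (b) (r%:Z) => u v t; rewrite /nm; nia.
have /dvdzP[q Eq] := p_dvd.
have q_gt0 : 0 < q by have := nm_ge0 a (-b); nia.
have [q1|q2] : q = 1 \/ q = 2 by nia.
  by exists a, (-b); rewrite Eq q1 mul1r.
(* If [q = 2], then 2, being inert, divides both coordinates; so 4 divides [2p] and [p = 2], against
   [p = 1] modulo 3. *)
have := @nm_inert 2 a (-b) isT erefl.
rewrite Eq q2 dvdz_mulr // => /(_ isT)/andP[/dvdzP[u Eu] /dvdzP[v Ev]].
move: Eq; rewrite q2 Eu Ev => E.
have : nm u v * 2 = p%:Z by move: E; rewrite /nm; lia.
move=> E2; have : (2 %| p)%N by lia.
by rewrite dvdn_prime2 // => /eqP p_eq2; move: p1; rewrite -p_eq2.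
Qed.

Definition eisenstein_norm (m : nat) := exists a b, nm a b = m%:Z.

(** Induction on [m]. An inert prime dividing a norm divides both coordinates, so its square can be
    removed. Conversely, a divisor [d > 1] that is itself a norm is split off: [p^2] for an inert
    prime factor [p] of [m], and [p] otherwise. *)
Lemma eisenstein_normP (m : nat) : (0 < m)%N ->
  eisenstein_norm m <->
  forall p, prime p -> (p %% 3 = 2)%N -> ~~ odd (logn p m).
Proof.
elim/ltn_ind: m => m IHm m_gt0; split=> [[a [b Em]] p p_pr p2|even_m].
  have [pm|npm] := boolP (p %| m)%N;
    last by rewrite lognE p_pr m_gt0 (negPf npm).
  have /andP[/dvdzP[u Eu] /dvdzP[v Ev]] : (p %| a)%Z && (p %| b)%Z.
    by apply: nm_inert => //; rewrite Em.
  have Em' : m%:Z = nm u v * (p * p)%N%:Z.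
    by rewrite -Em Eu Ev /nm PoszM; ring.
  have E : (m = `|nm u v| * (p * p))%N by have := nm_ge0 u v; lia.
  have n_gt0 : (0 < `|nm u v|)%N by move: m_gt0; rewrite E muln_gt0 => /andP[].
  have p_gt1 := prime_gt1 p_pr.
  rewrite E !lognM ?muln_gt0 ?n_gt0 ?prime_gt0 //
    (logn_prime _ p_pr) eqxx oddD addbF.
  have [|H _] := IHm `|nm u v|%N _ n_gt0; first by rewrite E; nia.
  by apply: H => //; exists u, v; have := nm_ge0 u v; lia.
have [->|m_neq1] := eqVneq m 1%N; first by exists 1, 0.
have p_pr : prime (pdiv m) by apply: pdiv_prime; lia.
have pm := pdiv_dvd m; move: (pdiv m) p_pr pm => p p_pr pm.
have p_gt1 := prime_gt1 p_pr.
suff [d [d_gt1 dm [c [e nd]] even_d]] : exists d, [/\ (1 < d)%N, (d %| m)%N,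
    eisenstein_norm d & forall l, prime l -> (l %% 3 = 2)%N ->
      ~~ odd (logn l d)].
  have /dvdnP[n E] := dm.
  have n_gt0 : (0 < n)%N by move: m_gt0; rewrite E muln_gt0 => /andP[].
  have [|_ H] := IHm n _ n_gt0; first by rewrite E; nia.
  have [|a [b nn]] := H.
    move=> l l_pr l2; have := even_m l l_pr l2.
    by rewrite E lognM ?oddD 1?(negPf (even_d _ l_pr l2)) ?addbF //; lia.
  by exists (a * c - b * e), (a * e + b * c - b * e); rewrite nm_mul nn nd E.
have [p0|p0] := eqVneq (p %% 3)%N 2%N.
  exists (p * p)%N; split; first by nia.
  - have := even_m p p_pr p0; rewrite mulnn (pfactor_dvdn 2 p_pr m_gt0).
    have : (0 < logn p m)%N by rewrite logn_gt0 mem_primes p_pr m_gt0.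
    by case: (logn p m) => [|[]].
  - by exists p%:Z, 0; rewrite /nm PoszM; ring.
  - by move=> l _ _; rewrite lognM ?(ltnW p_gt1) // oddD addbb.
exists p; split=> //; last first.
  move=> l l_pr l2; rewrite logn_prime //; case: eqP => // lp.
  by rewrite -lp l2 in p0.
have [p1|p1] := eqVneq (p %% 3)%N 1%N; first exact: nm_split.
have -> : p = 3%N by apply/esym/eqP; rewrite -dvdn_prime2 // /dvdn; lia.
by exists 1, (-1).
Qed.

(** An element of norm 1 modulo 3 must be brought to the form [3a - (3b + 1) w]. Unless 3 divides
    [x + y], and then the norm, it divides one of [x], [y], [x - y]; a swap of coordinates or
    multiplication by the unit [1 + w] makes this the first coordinate, and [key] adjusts the
    signs. *)
Lemma core3_star_neq0 (n : nat) :
  core3_star n != 0 <-> (n %% 3 = 1)%N /\ eisenstein_norm n.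
Proof.
rewrite /core3_star; case: (n %% 3 =P 1)%N => [n1|n1]; last by rewrite eqxx;
  split=> // -[].
split=> [/core3_neq0[a [b E]]|[_ [x [y E]]]].
  split=> //; exists (3 * a), (- (3 * b + 1)); rewrite /nm; lia.
suff [X [Y E']] : exists a b, nm (3 * a) (- (3 * b + 1)) = n%:Z.
  by apply/core3_neq0; exists X, Y; move: E'; rewrite /nm; lia.
have key (a b : int) : nm a b = n%:Z -> (3 %| a)%Z ->
    exists a b, nm (3 * a) (- (3 * b + 1)) = n%:Z.
  move=> Eab /dvdzP[u Eu].
  have [t [b0|[b1|b2]]] :
      exists t, b = 3 * t \/ b = 3 * t + 1 \/ b = 3 * t + 2.
    exists (b %/ 3)%Z.
    have := divz_eq b 3; have := @ltz_pmod b 3 isT; have := @modz_ge0 b 3 isT.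
    by move: (b %/ 3)%Z (b %% 3)%Z => ? ?; lia.
  - by move: Eab; rewrite Eu b0 /nm; lia.
  - by exists (- u), t; rewrite -Eab Eu b1 /nm; ring.
  - by exists u, (- t - 1); rewrite -Eab Eu b2 /nm; ring.
have [xy|nxy] := boolP (3 %| x + y)%Z.
  have /dvdzP[u Eu] := xy; have Ex : x = 3 * u - y by lia.
  have : n%:Z = 3 * (y ^+ 2 + 3 * u ^+ 2 - 3 * u * y).
    by rewrite -E Ex /nm; ring.
  by move: (_ - _) => w; lia.
have [x3|nx3] := boolP (3 %| x)%Z; first exact: key E x3.
have [y3|ny3] := boolP (3 %| y)%Z.
  by apply: (key y x) => //; rewrite -E /nm; ring.
by apply: (key (x - y) x); [rewrite -E /nm; ring | lia].
Qed.

(** * Eisenstein integers *)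

Section Eisenstein.
Variable R : realType.
Local Notation C := R[i].

Definition omega : C := (- 2^-1 +i* (Num.sqrt 3 / 2))%C.

Definition eis (a b : int) : C := a%:~R + b%:~R * omega.

Definition Eis : set C := [set x | exists a b, x = eis a b].

Lemma sqrt3_sqr : Num.sqrt 3 * Num.sqrt 3 = 3 :> R.
Proof. by rewrite -expr2 sqr_sqrtr. Qed.

Lemma omega_sqr : omega ^+ 2 = - 1 - omega.
Proof.
rewrite expr2; apply/eqP; rewrite eq_complex /=.
have := sqrt3_sqr; move: (Num.sqrt 3) => t tt.
by apply/andP; split; apply/eqP; [nra | lra].
Qed.

Lemma conj_omega : (omega^*)%C = - 1 - omega.
Proof. by apply/eqP; rewrite eq_complex /=; apply/andP; split; apply/eqP;
  lra. Qed.

Arguments omega : simpl never.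

Lemma eisM a b c d : eis a b * eis c d =
  eis (a * c - b * d) (a * d + b * c - b * d).
Proof.
rewrite /eis !(rmorphB, rmorphD, rmorphM) /=.
have -> : (a%:~R + b%:~R * omega) * (c%:~R + d%:~R * omega) =
  a%:~R * c%:~R + (a%:~R * d%:~R + b%:~R * c%:~R) * omega
  + b%:~R * d%:~R * omega ^+ 2 :> C by ring.
rewrite omega_sqr; ring.
Qed.

Lemma eisD a b c d : eis a b + eis c d = eis (a + c) (b + d).
Proof. rewrite /eis !rmorphD /=; ring. Qed.

Lemma eisN a b : - eis a b = eis (- a) (- b).
Proof. rewrite /eis !rmorphN /=; ring. Qed.

Lemma conjcD (x y : C) : (x + y)^*%C = x^*%C + y^*%C.
Proof. exact: rmorphD. Qed.

Lemma conjcM (x y : C) : (x * y)^*%C = x^*%C * y^*%C.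
Proof. exact: rmorphM. Qed.

Lemma conjc_int (n : int) : (n%:~R : C)^*%C = n%:~R.
Proof. exact: rmorph_int. Qed.

Lemma eis_conj a b : (eis a b)^*%C = eis (a - b) (- b).
Proof.
by rewrite /eis conjcD conjcM !conjc_int conj_omega rmorphB rmorphN /=; ring.
Qed.

Lemma eis_mul_conj a b : eis a b * (eis a b)^*%C = (nm a b)%:~R.
Proof.
rewrite eis_conj eisM /nm [X in eis _ X](_ : _ = 0); last by ring.
by rewrite /eis mul0r addr0; congr (_%:~R); ring.
Qed.

Lemma Re_eis a b : complex.Re (eis a b) = a%:~R - b%:~R / 2.
Proof.
rewrite /eis -(rmorph_int (real_complex R) a) -(rmorph_int (real_complex R) b)
  /=.
by lra.
Qed.

Lemma Im_eis a b : complex.Im (eis a b) = b%:~R * (Num.sqrt 3 / 2).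
Proof.
rewrite /eis -(rmorph_int (real_complex R) a) -(rmorph_int (real_complex R) b)
  /=.
by lra.
Qed.

Lemma eis_inj a b c d : eis a b = eis c d -> a = c /\ b = d.
Proof.
move=> E; have := congr1 (@complex.Im _) E; have := congr1 (@complex.Re _) E.
rewrite !Re_eis !Im_eis => ReE /mulIf ImE.
have /ImE/intr_inj Ebd : Num.sqrt 3 / 2 != 0 :> R.
  by rewrite mulf_neq0 // gt_eqF // sqrtr_gt0.
by split=> //; move: ReE; rewrite Ebd => /addIr/intr_inj.
Qed.

Lemma Eis_eis a b : Eis (eis a b). Proof. by exists a, b. Qed.

Lemma Eis_int (n : int) : Eis n%:~R.
Proof. by exists n, 0; rewrite /eis mul0r addr0. Qed.

Lemma Eis_nat (n : nat) : Eis n%:R. Proof. exact: (Eis_int n). Qed.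

Lemma Eis0 : Eis 0. Proof. exact: (Eis_int 0). Qed.
Lemma Eis1 : Eis 1. Proof. exact: (Eis_int 1). Qed.

Lemma EisD x y : Eis x -> Eis y -> Eis (x + y).
Proof. by move=> [a [b ->]] [c [d ->]]; rewrite eisD; apply: Eis_eis. Qed.

Lemma EisN x : Eis x -> Eis (- x).
Proof. by move=> [a [b ->]]; rewrite eisN; apply: Eis_eis. Qed.

Lemma EisB x y : Eis x -> Eis y -> Eis (x - y).
Proof. by move=> Ex Ey; apply: EisD => //; apply: EisN. Qed.

Lemma EisM x y : Eis x -> Eis y -> Eis (x * y).
Proof. by move=> [a [b ->]] [c [d ->]]; rewrite eisM; apply: Eis_eis. Qed.

Lemma EisX x n : Eis x -> Eis (x ^+ n).
Proof.
by move=> Ex; elim: n => [|n IHn]; [apply: Eis1 | rewrite exprS; apply: EisM].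
Qed.

Lemma Eis_conj x : Eis x -> Eis (x^*%C).
Proof. by move=> [a [b ->]]; rewrite eis_conj; apply: Eis_eis. Qed.

(* Outside [Eis] this is only the integer part of the norm. *)
Definition norm_eis (x : C) : nat := absz (Num.floor (complex.Re (x * x^*%C))).

Lemma norm_eisE a b : (norm_eis (eis a b))%:Z = nm a b.
Proof.
rewrite /norm_eis eis_mul_conj -(rmorph_int (real_complex R)) /= intrKfloor.
by rewrite gez0_abs // nm_ge0.
Qed.

Lemma norm_eis_mul_conj x : Eis x -> (norm_eis x)%:R = x * x^*%C.
Proof. by move=> [a [b ->]]; rewrite eis_mul_conj -norm_eisE. Qed.

Lemma norm_eisM x y : Eis x -> Eis y ->
  norm_eis (x * y) = (norm_eis x * norm_eis y)%N.
Proof.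
move=> Ex Ey; apply/eqP; rewrite -(eqr_nat C) natrM !norm_eis_mul_conj //;
  last exact: EisM.
by rewrite conjcM; apply/eqP; ring.
Qed.

Lemma norm_eis1 : norm_eis 1 = 1%N.
Proof.
apply/eqP; rewrite -(eqr_nat C) norm_eis_mul_conj ?rmorph1 ?mulr1 //.
exact: Eis1.
Qed.

Lemma norm_eis_conj x : Eis x -> norm_eis (x^*%C) = norm_eis x.
Proof.
move=> Ex; apply/eqP; rewrite -(eqr_nat C) !norm_eis_mul_conj //;
  last exact: Eis_conj.
by rewrite conjcK mulrC.
Qed.

Lemma norm_eis_eq0 x : Eis x -> (norm_eis x == 0%N) = (x == 0).
Proof.
move=> Ex; rewrite -(eqr_nat C) norm_eis_mul_conj // mulf_eq0.
by rewrite fmorph_eq0 orbb.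
Qed.

Lemma norm_eis_gt0 x : Eis x -> x != 0 -> (0 < norm_eis x)%N.
Proof. by move=> Ex; rewrite lt0n norm_eis_eq0. Qed.

Lemma norm_eis_nat n : norm_eis n%:R = (n ^ 2)%N.
Proof.
apply/eqP; rewrite -(eqr_nat C) norm_eis_mul_conj; last exact: Eis_nat.
by rewrite rmorph_nat natrX expr2.
Qed.

Lemma int_near (u n : int) : 0 < n -> exists q, 2 * `|u - q * n| <= n.
Proof.
move=> n_gt0; have E := divz_eq u n; have lt_n := ltz_pmod u n_gt0.
have := modz_ge0 u (lt0r_neq0 n_gt0).
move: (u %/ n)%Z (u %% n)%Z E lt_n => q r E lt_rn r_ge0.
by have [?|?] := lerP (2 * r) n; [exists q | exists (q + 1)]; rewrite E; nia.
Qed.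

(* Round the coordinates of [x / y = x y^* / N(y)] to the nearest integers. *)
Lemma eis_euclid x y : Eis x -> Eis y -> y != 0 ->
  exists q, Eis q /\ (norm_eis (x - q * y)%R < norm_eis y)%N.
Proof.
move=> Ex Ey y0; have ny := norm_eis_gt0 Ey y0.
have [u [v Euv]] := EisM Ex (Eis_conj Ey).
have nyZ : 0 < (norm_eis y)%:Z by [].
have [s Es] := int_near u nyZ; have [t Et] := int_near v nyZ.
exists (eis s t); split; first exact: Eis_eis.
have Eq : Eis (x - eis s t * y).
  by apply: EisB => //; apply: EisM => //; apply: Eis_eis.
rewrite -(ltn_pmul2r ny) -{1}(norm_eis_conj Ey) -norm_eisM //;
  last exact: Eis_conj.
have -> : (x - eis s t * y) * y^*%C =
    eis (u - s * (norm_eis y)%:Z) (v - t * (norm_eis y)%:Z).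
  rewrite mulrBl Euv -mulrA -norm_eis_mul_conj //.
  rewrite /eis !(rmorphB, rmorphM) /= -!pmulrn; ring.
rewrite -ltz_nat norm_eisE PoszM.
by move: Es Et nyZ; rewrite /nm; set a := u - _; set b := v - _; nia.
Qed.

Definition eis_ideal (I : set C) : Prop :=
  [/\ I `<=` Eis, (forall x y, I x -> I y -> I (x + y)) &
      forall c x, Eis c -> I x -> I (c * x)].

Definition eis_dvd (a x : C) : Prop := exists2 c, Eis c & x = a * c.

(** A nonzero element of least norm generates [I], because the remainder of any element on division
    by it lies in [I] and has smaller norm. *)
Lemma eis_pid I : eis_ideal I -> (exists2 x, I x & x != 0) ->
  exists2 a, I a /\ a != 0 & forall x, I x <-> eis_dvd a x.
Proof.
move=> [IE ID IM] [x0 Ix0 x0_neq0].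
pose P := [pred n | `[< exists2 x, I x /\ x != 0 & norm_eis x = n >]].
have exP : exists n, P n by exists (norm_eis x0); apply/asboolP; exists x0.
case: (ex_minnP exP) => n /asboolP[a [Ia a_neq0] na] min_n.
exists a => // x; split=> [Ix|[c Ec ->]]; last by rewrite mulrC; apply: IM.
have [q [Eq]] := eis_euclid (IE _ Ix) (IE _ Ia) a_neq0.
have Ir : I (x - q * a).
  by apply: ID => //; rewrite -mulNr; apply: IM => //; apply: EisN.
have [/eqP|r_neq0] := eqVneq (x - q * a) 0.
  by rewrite subr_eq0 => /eqP -> _; exists q => //; rewrite mulrC.
rewrite ltnNge na min_n //; apply/asboolP; by exists (x - q * a).
Qed.

Lemma eis_bezout x y : Eis x -> Eis y -> x != 0 ->
  exists d u v, [/\ Eis u, Eis v, d = x * u + y * v, eis_dvd d x & eis_dvd d y].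
Proof.
move=> Ex Ey x0.
pose I : set C := [set z | exists u v, [/\ Eis u, Eis v & z = x * u + y * v]].
have [||d [[u [v [Eu Ev Ed]]] d0] dP] := @eis_pid I.
- split.
  + by move=> _ [u [v [Eu Ev ->]]]; apply: EisD; apply: EisM.
  + move=> _ _ [u [v [Eu Ev ->]]] [u' [v' [Eu' Ev' ->]]].
    by exists (u + u'), (v + v'); split; [apply: EisD..|ring].
  + move=> c _ Ec [u [v [Eu Ev ->]]].
    by exists (c * u), (c * v); split; [apply: EisM..|ring].
- by exists x => //; exists 1, 0; split; [apply: Eis1 | apply: Eis0 | ring].
exists d, u, v; split=> //; apply/dP.
  by exists 1, 0; split; [apply: Eis1 | apply: Eis0 | ring].
by exists 0, 1; split; [apply: Eis0 | apply: Eis1 | ring].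
Qed.

Lemma eis_dvd_norm a x : Eis a -> eis_dvd a x -> (norm_eis a %| norm_eis x)%N.
Proof. by move=> Ea [c Ec ->]; rewrite norm_eisM ?dvdn_mulr. Qed.

Lemma eis_dvd_mul a x y : Eis y -> eis_dvd a x -> eis_dvd a (x * y).
Proof.
by move=> Ey [c Ec ->]; exists (c * y); [apply: EisM | rewrite mulrA].
Qed.

Lemma eis_dvdD a x y : eis_dvd a x -> eis_dvd a y -> eis_dvd a (x + y).
Proof.
by move=> [c Ec ->] [d Ed ->]; exists (c + d); [apply: EisD | rewrite mulrDr].
Qed.

Lemma eis_unit u : Eis u -> norm_eis u = 1%N -> u * u^*%C = 1.
Proof. by move=> Eu nu; rewrite -norm_eis_mul_conj // nu. Qed.

(** The gcd [d] of [pi] and [x] has norm 1 or that of [pi]. In the first case the Bezout relation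
    times the conjugate of [d] gives 1; in the second [d] is associate to [pi]. *)
Lemma eis_prime_coprime pi x : Eis pi -> prime (norm_eis pi) -> Eis x ->
  eis_dvd pi x \/ exists u v, [/\ Eis u, Eis v & pi * u + x * v = 1].
Proof.
move=> Epi pi_pr Ex.
have pi0 : pi != 0 by rewrite -norm_eis_eq0 // -lt0n prime_gt0.
have [d [u [v [Eu Ev Ed [c Ec Epic] [e Ee Exe]]]]] := eis_bezout Epi Ex pi0.
have Ed' : Eis d by rewrite Ed; apply: EisD; apply: EisM.
have /primeP[_ /(_ (norm_eis d))] := pi_pr.
rewrite {1}Epic norm_eisM // dvdn_mulr // => /(_ isT)/orP[]/eqP nd.
  right; exists (u * d^*%C), (v * d^*%C).
  have Edc := Eis_conj Ed'.
  split; [exact: EisM|exact: EisM|].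
  by rewrite -(eis_unit Ed' nd) [X in _ = X * _]Ed; ring.
left; have nc : norm_eis c = 1%N.
  apply/eqP; rewrite -(eqn_pmul2l (prime_gt0 pi_pr)) muln1 -{1}nd -norm_eisM //.
  by rewrite -Epic.
exists (c^*%C * e); first by apply: EisM => //; apply: Eis_conj.
by rewrite Exe Epic mulrA -(mulrA d) eis_unit // mulr1.
Qed.

Lemma eis_euclid_lemma pi x y :
  Eis pi -> prime (norm_eis pi) -> Eis x -> Eis y ->
  eis_dvd pi (x * y) -> eis_dvd pi x \/ eis_dvd pi y.
Proof.
move=> Epi pi_pr Ex Ey [c Ec Ec'].
have [|[u [v [Eu Ev E]]]] := eis_prime_coprime Epi pi_pr Ex; [by left | right].
exists (u * y + c * v); first by apply: EisD; apply: EisM.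
by rewrite mulrDr [pi * (c * v)]mulrA -Ec' -[LHS]mul1r -E; ring.
Qed.

End Eisenstein.

(** * The ring of integers of the field generated by the square root of -3 *)

Lemma rat_integral (F : numFieldType) (r : rat) :
  integralOver (intr : int -> F) (ratr r) -> exists n : int, r = n%:~R.
Proof.
case=> p p_mon; rewrite /root => /eqP p0.
have {p0} p0 : (map_poly intr p).[r] = 0 :> rat.
  apply: (fmorph_inj (ratr : rat -> F));
    rewrite rmorph0 -p0 -horner_map -map_poly_comp.
  by congr (_.[_]); apply: eq_map_poly => n /=; rewrite rmorph_int.
(* The same monic polynomial kills [r] in [algC], where rational algebraic integers are known to be
   integers. *)
have r_int : (ratr r : algC) \in Aint.
  apply: (@root_monic_Aint (map_poly intr p)).
  - rewrite /root.
    have -> : map_poly intr p =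
        map_poly ratr (map_poly intr p : {poly rat}) :> {poly algC}.
      by rewrite -map_poly_comp; apply: eq_map_poly => n /=; rewrite rmorph_int.
    by rewrite horner_map p0 rmorph0.
  - exact: monic_map.
  - by apply/polyOverP => i; rewrite coef_map /= intr_int.
have /intrP[n En] := Cint_rat_Aint (Crat_rat r) r_int.
by exists n; apply: (fmorph_inj (ratr : rat -> algC)); rewrite /= En rmorph_int.
Qed.

(** Numerator and denominator being coprime, the square of the denominator divides 3. *)
Lemma rat_3sqr_int (r : rat) (m : int) : 3 * r ^+ 2 = m%:~R ->
  exists n : int, r = n%:~R.
Proof.
move=> E; exists (numq r).
have d0 : (denq r)%:~R != 0 :> rat by rewrite intr_eq0 denq_neq0.
have {}E : 3 * numq r ^+ 2 = m * denq r ^+ 2.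
  apply/eqP; rewrite -(eqr_int rat) !rmorphM /= -E !numqE.
  by apply/eqP; ring.
have : (denq r ^+ 2 %| 3)%Z.
  rewrite -(@Gauss_dvdzl _ _ (numq r ^+ 2)); first by rewrite E dvdz_mull.
  rewrite coprimez_sym; apply: coprimezXl; apply: coprimezXr.
  exact: coprime_num_den.
rewrite dvdzE abszX => /(@dvdn_leq _ 3 isT) le_d3.
have d1 : denq r = 1 by have := denq_gt0 r; move: le_d3; nia.
by rewrite numqE d1 mulr1.
Qed.

Section Integers.
Variable R : realType.
Local Notation C := R[i].
Local Notation K := (@imag_quad_field R 3).
Local Notation Eis := (@Eis R).

(** For an integral [x = a + b sqrt(-3)], the trace [t = 2a] and the norm [n = a^2 + 3 b^2] are
    integral rationals, hence integers; then so is [s = 2b], and [4n = t^2 + 3 s^2] forces [t] and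
    [s] to have the same parity. *)
Lemma integers_eis : ring_of_integers K = Eis.
Proof.
apply/seteqP; split=> [x [[a [b Ex]] intx]|_ [a [b ->]]].
  set r3 : C := (0 +i* _)%C in Ex.
  have conj_r3 : (r3^*)%C = - r3.
    by apply/eqP; rewrite eq_complex /= oppr0 !eqxx.
  have conjx : (x^*)%C = ratr a - ratr b * r3.
    rewrite Ex conjcD (conjcM _ r3) conj_r3.
    rewrite mulrN; congr (_ - _ * _); exact: fmorph_rat.
  have intcx : integralOver (intr : int -> C) (x^*)%C.
    have := integral_rmorph (@conjc R) intx.
    have -> // : @conjc R \o intr = intr :> (int -> C).
    by apply/funext => n; apply: conjc_int.
  have s3 : r3 ^+ 2 = - 3 :> C.
    rewrite expr2; apply/eqP;
      rewrite eq_complex -(rmorph_nat (real_complex R)) /=.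
    by rewrite !mul0r mulr0 addr0 sub0r sqrt3_sqr oppr0 !eqxx.
  have [t Et] : exists n : int, 2 * a = n%:~R.
    apply: (@rat_integral C); rewrite rmorphM rmorph_nat /=.
    rewrite (_ : _ * _ = x + x^*%C); last by rewrite conjx Ex; ring.
    exact: integral_add.
  have [n En] : exists n : int, a ^+ 2 + 3 * b ^+ 2 = n%:~R.
    apply: (@rat_integral C).
    rewrite rmorphD rmorphM !rmorphXn rmorph_nat /=.
    rewrite (_ : _ + _ = x * x^*%C); first exact: integral_mul.
    rewrite conjx Ex.
    have -> (u v w : C) : (u + v * w) * (u - v * w) = u ^+ 2 - v ^+ 2 * w ^+ 2.
      by ring.
    rewrite s3; ring.
  have [s Es] : exists n : int, 2 * b = n%:~R.
    apply: (@rat_3sqr_int _ (4 * n - t ^+ 2)).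
    rewrite rmorphB rmorphM rmorphXn /= -Et -En; ring.
  have Est : 4 * n = t ^+ 2 + 3 * s ^+ 2.
    apply/eqP; rewrite -(eqr_int rat) rmorphD !rmorphM /= -Et -En -Es.
    by apply/eqP; ring.
  have [m Em] : exists m, t = 2 * m - s.
    exists ((t + s) %/ 2)%Z.
    have := divz_eq (t + s) 2; have := @ltz_pmod (t + s) 2 isT.
    have := @modz_ge0 (t + s) 2 isT.
    move: (_ %/ _)%Z (_ %% _)%Z => q r r0 r2 Eq.
    have [r0'|r1] : r = 0 \/ r = 1 by lia.
      by lia.
    have : t = 2 * q + 1 - s by lia.
    by move=> Et'; move: Est; rewrite Et'; lia.
  exists m, s.
  have -> : x = (2 * x) / 2 by field.
  have -> : 2 * x = ratr (2 * a) + ratr (2 * b) * r3.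
    by rewrite !rmorphM !rmorph_nat Ex; ring.
  rewrite Et Es !rmorph_int Em /eis rmorphB rmorphM /=.
  have -> : r3 = 2 * omega R + 1.
    apply/eqP; rewrite eq_complex -(rmorph_nat (real_complex R)) /=.
    by apply/andP; split; apply/eqP; lra.
  by field.
split.
  exists (a%:~R - b%:~R / 2), (b%:~R / 2).
  rewrite !(rmorphB, rmorphM) /= !fmorphV /= !rmorph_int !rmorph_nat.
  rewrite /eis.
  have -> : (0 +i* Num.sqrt 3)%C = 2 * omega R + 1.
    apply/eqP; rewrite eq_complex -(rmorph_nat (real_complex R)) /=.
    by apply/andP; split; apply/eqP; lra.
  by field.
apply: integral_add; first exact: integral_id.
apply: integral_mul; first exact: integral_id.
exists ('X^3 - 1%:P); first exact: monicXnsubC.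
rewrite /root rmorphB /= map_polyXn map_polyC /=.
rewrite hornerD hornerN hornerXn hornerC.
have -> : omega R ^+ 3 = 1.
  rewrite exprS omega_sqr.
  have -> : omega R * (-1 - omega R) = - omega R - omega R ^+ 2 by ring.
  by rewrite omega_sqr; ring.
by rewrite subrr.
Qed.

End Integers.

(** * Ideals of Z[w] *)

Section Ideals.
Variable R : realType.
Local Notation C := R[i].
Local Notation K := (@imag_quad_field R 3).
Local Notation Eis := (@Eis R).
Local Notation pid := (principal_ideal K).
Implicit Types (a b x y : C) (I J L : set C).

Lemma pidP a x : pid a x <-> eis_dvd a x.
Proof.
rewrite /principal_ideal integers_eis.
by split=> [[c Ec <-]|[c Ec ->]]; exists c.
Qed.

Lemma Eis_K x : Eis x -> K x.
Proof. by rewrite -integers_eis => -[]. Qed.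

Lemma pid_integral a : Eis a -> a != 0 -> is_integral_ideal K (pid a).
Proof.
move=> Ea a0; split; last first.
  by rewrite integers_eis => _ /pidP[c Ec ->]; apply: EisM.
split.
- by move=> _ /pidP[c Ec ->]; apply/Eis_K/EisM.
- by move=> x y /pidP ax /pidP ay; apply/pidP/eis_dvdD.
- move=> c x; rewrite integers_eis => Ec /pidP ax.
  by apply/pidP; rewrite mulrC; apply: eis_dvd_mul.
- by exists a => //; apply/pidP; exists 1; rewrite ?mulr1 //; apply: Eis1.
- exists 1; rewrite integers_eis; split; [exact: Eis1 | exact: oner_neq0|].
  by move=> _ /pidP[c Ec ->]; rewrite mul1r; apply: EisM.
Qed.

Lemma integral_ideal_pid I : is_integral_ideal K I ->
  exists2 a, Eis a /\ a != 0 & I = pid a.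
Proof.
rewrite /is_integral_ideal integers_eis => -[[_ ID IM [x0 Ix0 x00] _] IE].
have [||a [Ia a0] aP] := @eis_pid R I.
- by split=> //; rewrite -integers_eis.
  by exists x0.
exists a; first by split=> //; apply: IE.
by apply/seteqP; split=> x; [move/aP/pidP | move/pidP/aP].
Qed.

Lemma coprime_pid a b : Eis a -> Eis b ->
  coprime_ideals K (pid a) (pid b) <->
  exists u v, [/\ Eis u, Eis v & a * u + b * v = 1].
Proof.
move=> Ea Eb; rewrite /coprime_ideals integers_eis;
  split=> [E|[u [v [Eu Ev E]]]].
  have [_ [_ [/pidP[u Eu ->] /pidP[v Ev ->] E1]]] :
    ideal_add (pid a) (pid b) 1 by rewrite E; apply: Eis1.
  by exists u, v; split.
apply/seteqP; split=> x.
  by move=> [_ [_ [/pidP[s Es ->] /pidP[t Et ->] ->]]]; apply: EisD;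
    apply: EisM.
move=> Ex; exists (a * (u * x)), (b * (v * x)); split.
- by apply/pidP; exists (u * x) => //; apply: EisM.
- by apply/pidP; exists (v * x) => //; apply: EisM.
- by rewrite -[LHS]mul1r -E; ring.
Qed.

Lemma ideal_mul_pid a b : Eis a -> Eis b ->
  ideal_mul (pid a) (pid b) = pid (a * b).
Proof.
move=> Ea Eb; apply/seteqP; split=> x.
  move=> [n [u [v [uv ->]]]].
  apply/pidP; elim/big_ind : _ => [|x' y' |i _].
  - by exists 0; rewrite ?mulr0 //; apply: Eis0.
  - exact: eis_dvdD.
  - have [/pidP[s Es ->] /pidP[t Et ->]] := uv i.
    by exists (s * t); [apply: EisM | ring].
move/pidP=> [c Ec ->]; exists 1%N, (fun=> a), (fun=> b * c); split.
  move=> _; split; apply/pidP; last by exists c.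
  by exists 1; rewrite ?mulr1 //; apply: Eis1.
by rewrite big_ord1 mulrA.
Qed.

Lemma coprime_eis_ideal1 l : Eis l -> coprime_ideals K (pid 1) (pid l).
Proof.
move=> El; apply/coprime_pid => //; first exact: Eis1.
by exists 1, 0; split; [apply: Eis1 | apply: Eis0 | ring].
Qed.

Lemma pid_prime_to l a : Eis l -> Eis a -> a != 0 ->
  coprime_ideals K (pid a) (pid l) -> ideals_prime_to K (pid l) (pid a).
Proof.
move=> El Ea a0 al; have [fa _] := pid_integral Ea a0; split=> //.
exists (pid a), (pid 1); split=> //; first exact: pid_integral.
- by apply: pid_integral; [apply: Eis1 | apply: oner_neq0].
- exact: coprime_eis_ideal1.
- by rewrite ideal_mul_pid ?mulr1 //; apply: Eis1.
Qed.

Lemma pid_eq_dvd a b : Eis b -> pid a = pid b -> eis_dvd a b.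
Proof.
move=> Eb E; apply/pidP; rewrite E; apply/pidP.
by exists 1; rewrite ?mulr1 //; apply: Eis1.
Qed.

Lemma pid_mul_unit a u : Eis a -> Eis u -> norm_eis u = 1%N ->
  pid (a * u) = pid a.
Proof.
move=> Ea Eu nu; apply/seteqP; split=> x /pidP[c Ec ->]; apply/pidP.
  by exists (u * c); [apply: EisM | rewrite mulrA].
exists (u^*%C * c); first by apply: EisM => //; apply: Eis_conj.
by rewrite mulrA -(mulrA a) eis_unit ?mulr1.
Qed.

Definition add_coset (I : set C) (x : C) : set C := [set x + y | y in I].

Lemma add_coset_eq I x y : (forall u v, I u -> I v -> I (u - v)) -> I 0 ->
  add_coset I x = add_coset I y <-> I (x - y).
Proof.
move=> IB I0.
have IN u : I u -> I (- u) by move=> Iu; rewrite -sub0r; apply: IB.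
have ID u v : I u -> I v -> I (u + v).
  by move=> Iu Iv; rewrite -[v]opprK; apply: IB => //; apply: IN.
split=> [E|Ixy].
  have : add_coset I x x by exists 0; rewrite ?addr0.
  by rewrite E => -[z Iz <-]; rewrite addrC addKr.
apply/seteqP; split=> _ [z Iz <-].
  by exists (x - y + z); [apply: ID | ring].
by exists (z - (x - y)); [apply: IB | ring].
Qed.

(* With [g = gcd (a, b)] and [n = N (a + b w)], the lattice generated by
   [a + b w] and [(a + b w) w] has a basis [n/g, c + g w] in Hermite normal
   form. *)
Lemma eis_lattice (a b : int) (g := gcdz a b) :
  [/\ forall x y : int, eis_dvd (eis R a b) (eis R x y) -> (g %| y)%Z,
      exists c, eis_dvd (eis R a b) (eis R c g) &
      forall x : int, g != 0 ->
        eis_dvd (eis R a b) (eis R x 0) <-> (nm a b %| x * g)%Z].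
Proof.
have gl : (g %| a)%Z by apply: dvdz_gcdl.
have gr : (g %| b)%Z by apply: dvdz_gcdr.
split.
- move=> x y [_ [c [d ->]]]; rewrite eisM => /eis_inj[_ ->].
  by rewrite rpredB ?rpredD // ?dvdz_mulr // dvdz_mull.
- have [u [v Euv]] := Bezoutz a b.
  exists (a * (u + v) - b * u), (eis R (u + v) u); first exact: Eis_eis.
  by rewrite eisM; congr eis; rewrite -[g]/(gcdz a b) -Euv; ring.
- move=> x g0; split=> [[_ [c [d ->]]]|].
    rewrite eisM => /eis_inj[Ex Ey].
    have Ea : x * a = nm a b * (c - d) + (a * d + b * c - b * d) * (a - b).
      by rewrite Ex /nm; ring.
    have Eb : x * b = nm a b * (- d) + (a * d + b * c - b * d) * a.
      by rewrite Ex /nm; ring.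
    rewrite -Ey !mul0r !addr0 in Ea Eb.
    have [u [v Euv]] := Bezoutz a b.
    rewrite -/g in Euv; rewrite -Euv mulrDr ![x * (_ * _)]mulrCA Ea Eb.
    by rewrite rpredD // dvdz_mull // dvdz_mulr.
  case/dvdzP=> t Et; have /dvdzP[a' Ea] := gl; have /dvdzP[b' Eb] := gr.
  exists (eis R (t * (a' - b')) (- t * b')); first exact: Eis_eis.
  rewrite eisM; congr eis; apply: (mulIf g0).
    transitivity (t * (a * (a' * g - b' * g) + b * (b' * g))); last by ring.
    by rewrite -Ea -Eb Et /nm; ring.
  transitivity (t * (b * (a' * g) - a * (b' * g))); last by ring.
  by rewrite -Ea -Eb; ring.
Qed.

(** In the Hermite basis [e], [c0 + g w] of the ideal, where [e g = N(a)], the residue classes are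
    represented by the [i + j w] with [0 <= i < e] and [0 <= j < g], numbered by [j e + i]. *)
Lemma pid_norm a n : Eis a -> a != 0 ->
  has_ideal_norm K (pid a) n <-> n = norm_eis a.
Proof.
move=> Ea a0.
have IB u v : pid a u -> pid a v -> pid a (u - v).
  move=> /pidP[c Ec ->] /pidP[d Ed ->]; apply/pidP.
  by exists (c - d); [apply: EisB | rewrite mulrBr].
have I0 : pid a 0 by apply/pidP; exists 0; rewrite ?mulr0 //; apply: Eis0.
suff H : ([set add_coset (pid a) x | x in Eis] #= `I_(norm_eis a))%card.
  rewrite /has_ideal_norm integers_eis; split=> [H'|-> //].
  by apply/card_eq_II; apply: card_eq_trans H; rewrite card_eq_sym.
have [s [t Est]] := Ea.
have [Ly [c0 Lc] Lx] := eis_lattice s t.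
pose g := gcdz s t.
have g_neq0 : g != 0.
  rewrite /g gcdz_eq0; apply: contra a0 => /andP[/eqP s0 /eqP t0].
  by rewrite Est s0 t0 /eis mul0r addr0.
have g_ge0 : 0 <= g by [].
have g_gt0 : 0 < g by rewrite lt_neqAle eq_sym g_neq0.
have nmE : (norm_eis a)%:Z = nm s t by rewrite Est norm_eisE.
have nm_gt0 : 0 < nm s t by rewrite -nmE ltz_nat norm_eis_gt0.
have [e Ee] : exists e, nm s t = e * g.
  apply/dvdzP; rewrite /nm rpredD ?rpredB //.
  - by rewrite expr2 dvdz_mulr ?dvdz_gcdl.
  - by rewrite dvdz_mulr ?dvdz_gcdl.
  - by rewrite expr2 dvdz_mulr ?dvdz_gcdr.
have e_gt0 : 0 < e by move: nm_gt0; rewrite Ee pmulr_lgt0.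
have {}Lx (x : int) : eis_dvd a (eis R x 0) <-> (e %| x)%Z.
  by rewrite Est; split=> [/(Lx x g_neq0)|H]; [|apply/Lx => //];
    rewrite Ee dvdz_mul2r.
rewrite -Est in Ly Lc.
pose rep (k : nat) : C := eis R (k%:Z %% e)%Z (k%:Z %/ e)%Z.
have -> : [set add_coset (pid a) x | x in Eis] =
  (add_coset (pid a) \o rep) @` `I_(norm_eis a).
  apply/seteqP; split=> [_ [_ [x [y ->]] <-]|_ [k _ <-]].
    pose j := (y %% g)%Z; pose x' := x - (y %/ g)%Z * c0; pose i := (x' %% e)%Z.
    have j_ge0 : 0 <= j by apply: modz_ge0.
    have j_lt : j < g by apply: ltz_pmod.
    have i_ge0 : 0 <= i by apply: modz_ge0; rewrite lt0r_neq0.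
    have i_lt : i < e by apply: ltz_pmod.
    exists (absz (j * e + i)).
      rewrite /= -ltz_nat nmE Ee gez0_abs; nia.
    apply/add_coset_eq => //; rewrite /rep gez0_abs; last by nia.
    rewrite divzMDl ?lt0r_neq0 // modzMDl divz_small ?i_ge0 ?i_lt ?gtz0_abs //.
    rewrite modz_small ?i_ge0 ?i_lt ?gtz0_abs // addr0.
    have -> : eis R i j - eis R x y =
      - (eis R ((x' %/ e)%Z * e) 0 + (y %/ g)%Z%:~R * eis R c0 g).
      have Ey : y = (y %/ g)%Z * g + j by apply: divz_eq.
      have Ex : x = (x' %/ e)%Z * e + i + (y %/ g)%Z * c0.
        by rewrite -divz_eq subrK.
      move: (x' %/ e)%Z (y %/ g)%Z i j Ex Ey {j_ge0 j_lt i_ge0 i_lt}.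
      move=> u v i j -> ->.
      rewrite /eis !(rmorphD, rmorphM) /=; ring.
    rewrite -sub0r; apply: IB => //; apply/pidP/eis_dvdD.
      by apply/Lx; rewrite dvdz_mull.
    by rewrite mulrC; apply: eis_dvd_mul => //; apply: Eis_int.
  by exists (rep k) => //; apply: Eis_eis.
apply: inj_card_eq => k k' /[!inE] /= lt_k lt_k' /(add_coset_eq _ _ IB I0)/pidP.
rewrite /rep eisN eisD => Hd.
have lt_kz (l : nat) : (l < norm_eis a)%N -> 0 <= (l%:Z %/ e)%Z < g.
  rewrite -ltz_nat nmE Ee => lt_l.
  by rewrite divz_ge0 // le0z_nat ltz_divLR // mulrC.
have Ej : (k%:Z %/ e)%Z = (k'%:Z %/ e)%Z.
  have := lt_kz _ lt_k; have := lt_kz _ lt_k'; have /dvdzP[q] := Ly _ _ Hd.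
  rewrite -/g; move: (_ %/ _)%Z (_ %/ _)%Z => j j' Eq /andP[? ?] /andP[? ?].
  have q0 : q = 0 by nia.
  by move: Eq; rewrite q0; lia.
have Ei : (k%:Z %% e)%Z = (k'%:Z %% e)%Z.
  move: Hd; rewrite Ej subrr => /Lx/dvdzP[q].
  have := ltz_pmod k e_gt0; have := ltz_pmod k' e_gt0.
  have := modz_ge0 k (lt0r_neq0 e_gt0); have := modz_ge0 k' (lt0r_neq0 e_gt0).
  move: (_ %% _)%Z (_ %% _)%Z => i i' ? ? ? ? Eq.
  have q0 : q = 0 by nia.
  by move: Eq; rewrite q0; lia.
by apply/eqP; rewrite -eqz_nat (divz_eq k e) (divz_eq k' e) Ei Ej.
Qed.

End Ideals.

(** * Fourier coefficients of Hecke eigenforms *)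

(** The subtracted [x ^+ m] strengthens the bound so that the induction on [m] goes through. *)
Lemma geometric_tail (F : numFieldType) (x : F) (N m : nat) :
  0 <= x -> 2 * x <= 1 -> (N <= m)%N ->
  \sum_(N <= n < m) x ^+ n <= 2 * (x ^+ N - x ^+ m).
Proof.
move=> x_ge0 x_le /subnKC <-; elim: (m - N)%N => [|i IHi].
  by rewrite addn0 big_geq // subrr mulr0.
rewrite addnS big_nat_recr ?leq_addr //= (le_trans (lerD IHi (lexx _))) //.
rewrite -subr_ge0 exprS.
have -> : 2 * (x ^+ N - x * x ^+ (N + i))
    - (2 * (x ^+ N - x ^+ (N + i)) + x ^+ (N + i)) =
    (1 - 2 * x) * x ^+ (N + i) by ring.
by rewrite mulr_ge0 ?subr_ge0 ?exprn_ge0.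
Qed.

(** Convergence at [1/2] bounds the coefficients geometrically; for small [x] the first nonzero term
    would then dominate all later ones. The interval [0 < x < 1] is the image of the imaginary
    half-axis under [nome]. *)
Lemma power_series_uniq (F : numFieldType) (a : nat -> F) :
  (forall x, 0 < x < 1 ->
     (fun m => \sum_(1 <= n < m) a n * x ^+ n : F^o) @ \oo --> (0 : F^o)) ->
  forall n, (0 < n)%N -> a n = 0.
Proof.
move=> cvg0.
have {}cvg0 (x e : F) : 0 < x < 1 -> 0 < e ->
    exists m0, forall m, (m0 <= m)%N -> `|\sum_(1 <= n < m) a n * x ^+ n| < e.
  move=> /cvg0/cvgr0Pnorm_lt/(_ e) H e_gt0; have [m0 _ Hm0] := H e_gt0.
  by exists m0 => m le_m; apply: Hm0.
have [B B_ge0 aB] : exists2 B, 0 <= B & forall n, (0 < n)%N ->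
  `|a n| <= B * 2 ^+ n.
  have [||m0 Hm0] := cvg0 2^-1 1 => //.
    by rewrite invr_gt0 ltr0n invf_lt1 ?ltr1n ?ltr0n.
  (* From [m0] on, each term at [1/2] is a difference of two partial sums of absolute value below 1;
     the finite sum takes care of the earlier terms. *)
  exists (2 + \sum_(1 <= n < m0) `|a n| / 2 ^+ n).
    by rewrite addr_ge0 // sumr_ge0 // => n _; rewrite divr_ge0 ?exprn_ge0.
  move=> n n_gt0; rewrite -ler_pdivrMr ?exprn_gt0 //.
  have [le_mn|lt_nm] := leqP m0 n.
    rewrite (@le_trans _ _ 2) //; last first.
      by rewrite lerDl sumr_ge0 // => i _; rewrite divr_ge0 ?exprn_ge0.
    have -> : `|a n| / 2 ^+ n = `|a n * 2^-1 ^+ n|.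
      by rewrite normrM normrX normfV normr_nat exprVn.
    have -> : a n * 2^-1 ^+ n =
       \sum_(1 <= i < n.+1) a i * 2^-1 ^+ i - \sum_(1 <= i < n) a i * 2^-1 ^+ i.
      by rewrite big_nat_recr //= addrAC subrr add0r.
    rewrite (le_trans (ler_normB _ _)) // (natrD _ 1 1) lerD // ltW // Hm0 //.
    exact: leqW.
  rewrite ler_wpDl // (bigD1_seq n) ?mem_index_iota ?iota_uniq ?n_gt0 //=.
  by rewrite lerDl sumr_ge0 // => i _; rewrite divr_ge0 ?exprn_ge0.
elim/ltn_ind => N IHN N_gt0; apply/eqP; apply: contraT => aN_neq0.
have aN_gt0 : 0 < `|a N| by rewrite normr_gt0.
(* The terms beyond [N] add up to at most [2 B (2x)^(N+1) = D x^(N+1)]. The point [x] is chosen so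
   that [4x <= 1] and [D x] is less than the absolute value of [a N]. *)
pose D := B * 2 ^+ N.+2.
have D_ge0 : 0 <= D by rewrite mulr_ge0 ?exprn_ge0.
have den_gt0 : 0 < 4 * `|a N| + 2 * D.
  apply: ltr_wpDr; first by rewrite mulr_ge0.
  by apply: mulr_gt0; rewrite ?ltr0n.
pose x := `|a N| / (4 * `|a N| + 2 * D).
have x_gt0 : 0 < x by rewrite divr_gt0.
have x4 : 4 * x <= 1.
  by rewrite mulrA ler_pdivrMr // mul1r lerDl mulr_ge0.
have Dx : D * x < `|a N|.
  rewrite mulrA ltr_pdivrMr // mulrC mulrDr -subr_gt0.
  have -> : `|a N| * (4 * `|a N|) + `|a N| * (2 * D) - `|a N| * D =
     `|a N| * (4 * `|a N| + D) by ring.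
  by rewrite mulr_gt0 // ltr_wpDr ?mulr_gt0 ?ltr0n.
move: x x_gt0 x4 Dx => x x_gt0 x4 Dx {den_gt0}.
have x_lt1 : 0 < x < 1.
  rewrite x_gt0 (lt_le_trans _ x4) // -subr_gt0 -{2}[x]mul1r -mulrBl.
  by rewrite mulr_gt0 // subr_gt0 ltr1n.
pose e := (`|a N| - D * x) * x ^+ N.
have e_gt0 : 0 < e by rewrite mulr_gt0 ?subr_gt0 ?exprn_gt0.
have [m0 /(_ (m0 + N.+1)%N (leq_addr _ _))] := cvg0 x e x_lt1 e_gt0.
rewrite (@big_cat_nat _ _ _ N) //=; last by rewrite ltnW // leq_addl.
rewrite big_nat big1 ?add0r; last first.
  by move=> i /andP[i_gt0 i_lt]; rewrite IHN ?mul0r.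
rewrite (@big_cat_nat _ _ _ N.+1 N) ?leq_addl //= big_nat1.
set T := \sum_(N.+1 <= _ < _) _ => lt_e.
have T_le : `|T| <= D * x * x ^+ N.
  rewrite (le_trans (ler_norm_sum _ _ _)) //.
  have H i : (N.+1 <= i < m0 + N.+1)%N -> `|a i * x ^+ i| <= B * (2 * x) ^+ i.
    move=> /andP[i_gt _]; rewrite normrM normrX (gtr0_norm x_gt0) exprMn mulrA.
    apply: ler_wpM2r; first by rewrite exprn_ge0 // ltW.
    by apply: aB; apply: leq_trans i_gt.
  rewrite (le_trans (ler_sum_nat H)) // -mulr_sumr.
  have tx : 2 * (2 * x) <= 1 by rewrite mulrA -natrM.
  have x_ge0 := ltW x_gt0.
  rewrite (le_trans (ler_wpM2l B_ge0 (geometric_tail _ tx (leq_addl _ _))))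
    ?mulr_ge0 //.
  have -> : D * x * x ^+ N = B * (2 * (2 * x) ^+ N.+1).
    by rewrite /D exprMn !exprS; ring.
  by rewrite ler_wpM2l // ler_wpM2l // lerBlDr lerDl exprn_ge0 // mulr_ge0.
have aN_le : `|a N| * x ^+ N <= `|a N * x ^+ N + T| + `|T|.
  rewrite -[X in _ * X](gtr0_norm (exprn_gt0 N x_gt0)) -normrM.
  by rewrite -{1}[a N * x ^+ N](addrK T) ler_normB.
have : `|a N| * x ^+ N - D * x * x ^+ N < e.
  by rewrite (le_lt_trans _ lt_e) // lerBlDr (le_trans aN_le) // lerD2l.
by rewrite /e mulrBl ltxx.
Qed.

(** The new bound is [M / p] rounded up: [p d < M] holds exactly for the [d] below it. *)
Lemma sum_dvdn (V : zmodType) (p M : nat) (G : nat -> V) : (0 < p)%N ->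
  \sum_(1 <= n < M) (if (p %| n)%N then G (n %/ p)%N else 0) =
  \sum_(1 <= n < (M + p.-1) %/ p) G n.
Proof.
move=> p_gt0; case: p p_gt0 => // q _ /=; elim: M => [|[|M] IHM].
- by rewrite !big_geq // add0n divn_small.
- by rewrite !big_geq // add1n divnn.
rewrite big_nat_recr //= IHM.
have -> : ((M.+2 + q) %/ q.+1 = (M.+1 %/ q.+1).+1)%N.
  by rewrite addSnnS divnDr // divnn addn1.
have -> : ((M.+1 + q) %/ q.+1 = M.+1 %/ q.+1 + ~~ (q.+1 %| M.+1))%N.
  rewrite {1}(divn_eq M.+1 q.+1) -addnA divnMDl // /dvdn; congr addn.
  have := ltn_pmod M.+1 (ltn0Sn q); case: (_ %% _)%N => [|r] lt_r /=.
    by rewrite divn_small.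
  by rewrite addSnnS divnDr // divnn divn_small // ltnW.
case: (boolP (_ %| _)%N) => [dv|_] /=; last by rewrite addn1 addr0.
by rewrite addn0 big_nat_recr //= divn_gt0 // dvdn_leq.
Qed.

Section Fourier.
Variable R : realType.
Local Notation C := R[i].
Implicit Types (z : C).

Lemma cexpD (x y : C) : cexp (x + y) = cexp x * cexp y.
Proof.
case: x y => [a b] [c d]; rewrite /cexp /= expRD cosD sinD.
by apply/eqP; rewrite eq_complex /=; apply/andP; split; apply/eqP; ring.
Qed.

Lemma cexp0 : cexp 0 = 1 :> C.
Proof.
rewrite /cexp /= expR0 cos0 sin0.
by apply/eqP; rewrite eq_complex /=; apply/andP; split; apply/eqP; ring.
Qed.

Lemma cexpMn (x : C) n : cexp (n%:R * x) = cexp x ^+ n.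
Proof.
elim: n => [|n IHn]; first by rewrite mul0r cexp0.
by rewrite -natr1 mulrDl mul1r cexpD IHn exprSr.
Qed.

Definition nome (z : C) : C := cexp (2 * (pi : R)%:C%C * 'i%C * z).

Lemma nomeD z w : nome (z + w) = nome z * nome w.
Proof. by rewrite /nome mulrDr cexpD. Qed.

Lemma nomeMn n z : nome (n%:R * z) = nome z ^+ n.
Proof. by rewrite /nome mulrCA cexpMn. Qed.

Lemma nome1 : nome 1 = 1.
Proof.
rewrite /nome mulr1 /cexp -(rmorph_nat (real_complex R)) /=.
rewrite !(mulr0, mul0r, mulr1, addr0, subr0, add0r, oppr0) expR0.
rewrite mulr_natl cos2pi sin2pi.
by apply/eqP; rewrite eq_complex /=; apply/andP; split; apply/eqP; ring.
Qed.

(** The angle [2 pi / p] is positive and at most [pi], so its cosine is less than 1. *)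
Lemma nome_inv_neq1 p : (1 < p)%N -> nome p%:R^-1 != 1.
Proof.
move=> p_gt1; rewrite /nome /cexp -!(rmorph_nat (real_complex R)) -fmorphV /=.
rewrite !(mulr0, mul0r, mulr1, addr0, subr0, add0r, oppr0) expR0.
rewrite eq_complex /= !(mulr0, mul0r, mulr1, addr0, subr0, add0r, mul1r).
have p_gt0 : 0 < p%:R :> R by rewrite ltr0n ltnW.
have pi_gt0 := pi_gt0 R.
have x_gt0 : 0 < 2 * pi / p%:R :> R by rewrite divr_gt0 // mulr_gt0.
have x_pi : 2 * pi / p%:R \in `[0, pi :> R].
  rewrite in_itv /= ltW //= ler_pdivrMr // mulrC ler_pM2l //.
  by rewrite (ler_nat _ 2).
have z_pi : 0 \in `[0, pi :> R] by rewrite in_itv /= lexx ltW.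
have lt1 : cos (2 * pi / p%:R) < 1 :> R.
  by rewrite -[X in _ < X]cos0; move: (ltr_cos z_pi x_pi) => ->.
by rewrite negb_and lt_eqF.
Qed.

Lemma nome_imag (x : C) : 0 < x < 1 ->
  exists y : R, 0 < y /\ nome (0 +i* y)%C = x.
Proof.
case: x => r i /andP[]; rewrite !ltcE /= => /andP[/eqP -> r_gt0] /andP[_ r_lt1].
have pi2_gt0 : 0 < 2 * pi :> R by rewrite mulr_gt0 ?pi_gt0.
exists ((- ln r) / (2 * pi)); split.
  by apply: divr_gt0 => //; rewrite oppr_gt0 ln_lt0 // r_gt0.
rewrite /nome /cexp -(rmorph_nat (real_complex R)) /=.
rewrite !(mulr0, mul0r, mulr1, addr0, subr0, sub0r, add0r, oppr0) cos0 sin0.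
rewrite [2 * pi * _]mulrC divfK ?gt_eqF // opprK lnK //.
by apply/eqP; rewrite eq_complex /=; apply/andP; split; apply/eqP; ring.
Qed.

Lemma cusp_expansion_nome (A : nat -> C) (f : C -> C) z :
  cusp_expansion 1 A f -> upper_half_plane z ->
  (fun m => \sum_(1 <= n < m) A n * nome z ^+ n : C^o) @ \oo --> (f z : C^o).
Proof.
move=> Af /Af; rewrite (_ : (fun _ => _) =
  fun m => \sum_(1 <= n < m) A n * nome z ^+ n) //.
apply/funext => m; apply: eq_bigr => n _; rewrite -nomeMn /nome.
by congr (_ * cexp _); rewrite divr1; ring.
Qed.

(** As [p] is prime, [zeta] has exact order [p], so the geometric sum vanishes unless [p] divides
    [n]. *)
Lemma sum_unity_root (p n : nat) (zeta : C) : prime p -> zeta ^+ p = 1 ->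
  zeta != 1 ->
  \sum_(j < p) zeta ^+ (n * j) = if (p %| n)%N then p%:R else 0.
Proof.
move=> p_pr zp z1; case: ifP => [/dvdnP[m ->]|/negbT npn].
  rewrite (eq_bigr (fun=> 1)) ?sumr_const ?card_ord // => j _.
  by rewrite mulnAC mulnC exprM zp expr1n.
have zn1 : zeta ^+ n != 1.
  apply: contra z1 => /eqP zn.
  have /coprimeP : coprime n p by rewrite coprime_sym prime_coprime.
  have n_gt0 : (0 < n)%N by case: n npn {zn} => //; rewrite dvdn0.
  move=> /(_ n_gt0)[[u v] /= uv].
  have : zeta ^+ (u * n) = zeta ^+ (v * p + 1) by congr (_ ^+ _); lia.
  by rewrite exprD (mulnC u) (mulnC v) !exprM zn zp !expr1n mul1r expr1 => <-.
apply: (mulfI (_ : zeta ^+ n - 1 != 0)); first by rewrite subr_eq0.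
under eq_bigr do rewrite exprM.
by rewrite -subrX1 -exprM mulnC exprM zp expr1n subrr mulr0.
Qed.

Lemma cvg_big_sum (p : nat) (g : 'I_p -> nat -> C) (l : 'I_p -> C) :
  (forall j, (g j : nat -> C^o) @ \oo --> (l j : C^o)) ->
  (fun m => \sum_(j < p) g j m : C^o) @ \oo --> (\sum_(j < p) l j : C^o).
Proof.
elim: p g l => [|p IHp] g l gl.
  rewrite big_ord0 (_ : (fun _ => _) = fun=> 0); first exact: cvg_cst.
  by apply/funext => m; rewrite big_ord0.
rewrite big_ord_recl (_ : (fun _ => _) =
    (g ord0 : nat -> C^o) + (fun m => \sum_(j < p) g (lift ord0 j) m)).
  by apply: cvgD; [apply: gl | apply: IHp => j; apply: gl].
by apply/funext => m; rewrite big_ord_recl.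
Qed.

Lemma upper_half_nat_mul (n : nat) z : (0 < n)%N ->
  upper_half_plane z -> upper_half_plane (n%:R * z).
Proof.
case: z => x y n_gt0; rewrite /upper_half_plane /=.
rewrite -(rmorph_nat (real_complex R)) /=.
by move=> y_gt0; rewrite mul0r addr0 mulr_gt0 ?ltr0n.
Qed.

Lemma upper_half_hecke (p j : nat) z : (0 < p)%N ->
  upper_half_plane z -> upper_half_plane ((z + j%:R) / p%:R).
Proof.
case: z => x y p_gt0; rewrite /upper_half_plane /=.
rewrite -!(rmorph_nat (real_complex R)) -fmorphV /=.
by move=> y_gt0; rewrite mulr0 add0r addr0 mulr_gt0 ?invr_gt0 ?ltr0n.
Qed.

(** The action of [T_p] on Fourier coefficients. On the imaginary axis the eigenvalue equation
    becomes an identity of power series in [x = nome z]; averaging over [j] keeps the exponents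
    divisible by [p]. *)
Lemma hecke_coef (k p : nat) (f : C -> C) (A : nat -> C) (lam : C) :
  prime p -> cusp_expansion 1 A f ->
  (forall z, upper_half_plane z -> hecke k p f z = lam * f z) ->
  forall n, (0 < n)%N ->
    A (p * n)%N + (if (p %| n)%N then p%:R ^+ k.-1 * A (n %/ p)%N else 0)
    = lam * A n.
Proof.
move=> p_pr Af eig n n_gt0; have p_gt0 := prime_gt0 p_pr.
have p0 : p%:R != 0 :> C by rewrite pnatr_eq0 -lt0n.
apply/eqP; rewrite -subr_eq0; apply/eqP; move: n n_gt0.
apply: power_series_uniq => x /nome_imag[y [y_gt0 Ex]].
set z : C := (0 +i* y)%C in Ex.
have z_up : upper_half_plane z by [].
pose zeta := nome p%:R^-1; pose w := nome (z / p%:R).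
have zp : zeta ^+ p = 1 by rewrite -nomeMn divff // nome1.
have z1 : zeta != 1 by apply: nome_inv_neq1; apply: prime_gt1.
have wp : w ^+ p = x by rewrite -nomeMn mulrC divfK.
have C1 := cusp_expansion_nome Af (upper_half_nat_mul p_gt0 z_up).
have C2 (j : 'I_p) := cusp_expansion_nome Af (upper_half_hecke j p_gt0 z_up).
have C3 := cusp_expansion_nome Af z_up.
(* The three series are cut at [m / p] rounded up, at [p m] and at [m], so that as sums in powers of
   [x] they all run over the exponents below [m]. *)
have cvg_ceil : (fun m => (m + p.-1) %/ p)%N @ \oo --> \oo.
  move=> P [N _ PN]; exists (N * p)%N => //= m le_m; apply: PN => /=.
  by rewrite leq_divRL // (leq_trans le_m) // leq_addr.
have {}C1 : (fun m => p%:R ^+ k.-1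
      * \sum_(1 <= n < (m + p.-1) %/ p) A n * nome (p%:R * z) ^+ n : C^o)
      @ \oo --> (p%:R ^+ k.-1 * f (p%:R * z) : C^o).
  apply: cvgMl_tmp; exact: (cvg_comp _ _ cvg_ceil C1).
have {}C2 : (fun m => p%:R^-1 * \sum_(j < p) \sum_(1 <= n < p * m)
     A n * nome ((z + j%:R) / p%:R) ^+ n : C^o) @ \oo -->
    (p%:R^-1 * \sum_(j < p) f ((z + j%:R) / p%:R) : C^o).
  apply: cvgMl_tmp; exact: (cvg_comp _ _ (cvg_mulnl p p_gt0) (cvg_big_sum C2)).
have {}C3 : (fun m => lam * \sum_(1 <= n < m) A n * nome z ^+ n : C^o) @ \oo
    --> (lam * f z : C^o).
  apply: cvgMl_tmp; exact: C3.
pose U m : C :=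
  p%:R ^+ k.-1 * \sum_(1 <= n < (m + p.-1) %/ p) A n * nome (p%:R * z) ^+ n
  + p%:R^-1 * \sum_(j < p) \sum_(1 <= n < p * m)
      A n * nome ((z + j%:R) / p%:R) ^+ n
  - lam * \sum_(1 <= n < m) A n * nome z ^+ n.
have cvgU : (U : nat -> C^o) @ \oo --> (p%:R ^+ k.-1 * f (p%:R * z)
    + p%:R^-1 * \sum_(j < p) f ((z + j%:R) / p%:R) - lam * f z : C^o).
  exact: cvgB (cvgD C1 C2) C3.
have {eig} eig0 : p%:R ^+ k.-1 * f (p%:R * z)
    + p%:R^-1 * \sum_(j < p) f ((z + j%:R) / p%:R) - lam * f z = 0.
  by rewrite -eig // subrr.
rewrite eig0 in cvgU.
rewrite (_ : (fun _ => _) = U) //; apply/funext => m; rewrite /U.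
rewrite Ex nomeMn Ex.
have -> : \sum_(j < p) \sum_(1 <= n < p * m) A n * nome ((z + j%:R) / p%:R) ^+ n
    = \sum_(1 <= n < m) p%:R * (A (p * n)%N * x ^+ n).
  rewrite exchange_big /=.
  have Em : ((p * m + p.-1) %/ p = m)%N.
    by rewrite mulnC divnMDl // divn_small ?addn0 // prednK.
  have := sum_dvdn (p * m) (fun n => p%:R * (A (p * n)%N * x ^+ n)) p_gt0.
  rewrite Em => <-.
  apply: eq_bigr => n _.
  rewrite (eq_bigr (fun j : 'I_p => A n * w ^+ n * zeta ^+ (n * j)));
    last first.
    move=> j _; rewrite mulrDl nomeD -/w nomeMn -/zeta exprMn -exprM mulrA.
    by rewrite [(j * n)%N]mulnC.
  rewrite -mulr_sumr sum_unity_root //; case: ifP => [/dvdnP[d ->]|_];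
    last by rewrite mulr0.
  by rewrite mulnK // mulnC exprM wp; ring.
have -> : p%:R ^+ k.-1 * \sum_(1 <= n < (m + p.-1) %/ p) A n * (x ^+ p) ^+ n =
    \sum_(1 <= n < m) (if (p %| n)%N then p%:R ^+ k.-1 * A (n %/ p)%N else 0) *
      x ^+ n.
  rewrite mulr_sumr.
  rewrite -(sum_dvdn m (fun n => p%:R ^+ k.-1 * (A n * (x ^+ p) ^+ n))) //.
  apply: eq_bigr => n _; case: ifP => [/dvdnP[d ->]|_]; last by rewrite mul0r.
  by rewrite mulnK // mulnC exprM mulrA.
rewrite -mulr_sumr mulKf // mulr_sumr -big_split -sumrB /=.
by apply: eq_bigr => n _; ring.
Qed.

End Fourier.

(** * Primes of Z[w] *)

Section EisensteinPrimes.
Variable R : realType.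
Local Notation C := R[i].
Local Notation Eis := (@Eis R).
Local Notation K := (@imag_quad_field R 3).
Local Notation pid := (principal_ideal K).

Lemma eis_dvd_conj (a x : C) : eis_dvd a x -> eis_dvd (a^*)%C (x^*)%C.
Proof.
by move=> [c Ec ->]; exists (c^*)%C; [apply: Eis_conj | rewrite conjcM].
Qed.

Lemma eis_dvd1 (a : C) : Eis a -> eis_dvd a 1 -> norm_eis a = 1%N.
Proof.
by move=> Ea /(eis_dvd_norm Ea); rewrite norm_eis1 dvdn1 => /eqP.
Qed.

Lemma eis_neq0 (a : C) n : Eis a -> norm_eis a = n -> (0 < n)%N -> a != 0.
Proof. by move=> Ea <-; rewrite lt0n norm_eis_eq0. Qed.

Lemma eis_dvdX pi x n : Eis pi -> prime (norm_eis pi) -> Eis x ->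
  eis_dvd pi (x ^+ n) -> eis_dvd pi x.
Proof.
move=> Epi pi_pr Ex; elim: n => [|n IHn].
  by move/(eis_dvd1 Epi) => n1; move: pi_pr; rewrite n1.
rewrite exprS => /(eis_euclid_lemma Epi pi_pr Ex (EisX n Ex))[//|]; exact: IHn.
Qed.

Lemma eis_dvd_inert (p : nat) (x : C) : prime p -> (p %% 3 = 2)%N -> Eis x ->
  (p %| norm_eis x)%N -> eis_dvd p%:R x.
Proof.
move=> p_pr p2 [a [b ->]] px.
have /andP[/dvdzP[u Eu] /dvdzP[v Ev]] : (p %| a)%Z && (p %| b)%Z.
  by apply: nm_inert => //; rewrite -(norm_eisE R).
exists (eis R u v); first exact: Eis_eis.
by rewrite Eu Ev /eis !rmorphM /= -!pmulrn; ring.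
Qed.

(** [1 + 2w] is the square root of -3 in the upper half-plane. *)
Definition sqrtN3 : C := eis R 1 2.

Lemma Eis_sqrtN3 : Eis sqrtN3. Proof. exact: Eis_eis. Qed.

Lemma norm_sqrtN3 : norm_eis sqrtN3 = 3%N.
Proof. by have := norm_eisE R 1 2; rewrite /nm => -[]. Qed.

Lemma sqrtN3_dvd (x : C) : Eis x -> (3 %| norm_eis x)%N -> eis_dvd sqrtN3 x.
Proof.
move=> [a [b ->]] x3.
have : (3 %| nm a b)%Z by rewrite -(norm_eisE R).
have -> : nm a b = (a + b) ^+ 2 - 3 * (a * b) by rewrite /nm; ring.
move=> /dvdzP[t Et]; have : (3%N %| (a + b) ^+ 2)%Z.
  by apply/dvdzP; exists (t + a * b); lia.
rewrite prime_dvdz_exp // andbT => /dvdzP[q Eq].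
(* The quotient of [a + b w] by [1 + 2w], where [a + b = 3q]. *)
exists (eis R (2 * q - a) (q - a)); first exact: Eis_eis.
by rewrite /sqrtN3 eisM; congr eis; lia.
Qed.

(** * Primes that split *)

Section Split.
Variables (p : nat) (pi : C).
Hypotheses (p_pr : prime p) (p1 : (p %% 3 = 1)%N).
Hypotheses (Epi : Eis pi) (n_pi : norm_eis pi = p).

Let pi_pr : prime (norm_eis pi). Proof. by rewrite n_pi. Qed.
Let pi0 : pi != 0. Proof. exact: eis_neq0 n_pi (prime_gt0 p_pr). Qed.
Let pic0 : (pi^*)%C != 0. Proof. by rewrite conjc_eq0. Qed.

(** Otherwise [pi] divides the integer [t = pi + pi^*], so [p] divides [t]. For [pi = a + b w] one
    has [4p = t^2 + 3 b^2]; so [p] divides [b], and [p^2] divides [4p], which leaves only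
    [p = 2]. *)
Lemma split_not_dvd_conj : ~ eis_dvd pi (pi^*)%C.
Proof.
move=> dv; have p_gt1 := prime_gt1 p_pr.
have dv_tr : eis_dvd pi (pi + (pi^*)%C).
  apply: eis_dvdD => //; exists 1; rewrite ?mulr1 //; exact: Eis1.
have [a [b Eab]] := Epi.
have tr : pi + (pi^*)%C = (2 * a - b)%:~R.
  by rewrite Eab eis_conj eisD /eis subrr mul0r addr0; congr (_%:~R); ring.
have nab : nm a b = p%:Z by rewrite -(norm_eisE R) -Eab n_pi.
have p_tr : (p %| 2 * a - b)%Z.
  have := eis_dvd_norm Epi dv_tr; rewrite n_pi tr.
  have -> : norm_eis ((2 * a - b)%:~R : C) = (absz (2 * a - b)%R ^ 2)%N.
    have := norm_eisE R (2 * a - b) 0.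
    rewrite /eis mul0r addr0 /nm => E; apply/eqP; rewrite -eqz_nat E; lia.
  by rewrite Euclid_dvdX // andbT dvdzE.
have p_b : (p %| b)%Z.
  have : (p %| 3 * b ^+ 2)%Z.
    have -> : 3 * b ^+ 2 = 4 * p%:Z - (2 * a - b) ^+ 2.
      by rewrite -nab /nm; ring.
    by rewrite rpredB ?dvdz_mull // (@prime_dvdz_exp p) // p_tr.
  rewrite prime_dvdz_mul // prime_dvdz_exp // andbT => /orP[|//].
  by rewrite dvdzE /= dvdn_prime2 // => /eqP p3; move: p1; rewrite p3.
have /dvdzP[u Eu] := p_tr; have /dvdzP[v Ev] := p_b.
have E4 : p%:Z * (u ^+ 2 + 3 * v ^+ 2) = 4.
  have p0 : p%:Z != 0 by rewrite eqz_nat -lt0n prime_gt0.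
  apply: (mulfI p0); transitivity ((2 * a - b) ^+ 2 + 3 * b ^+ 2).
    by rewrite Eu Ev; ring.
  by rewrite mulrC -nab /nm; ring.
have : (p %| 4)%N.
  by have := dvdz_mulr (u ^+ 2 + 3 * v ^+ 2) (dvdzz p); rewrite E4 dvdzE.
rewrite (Euclid_dvdM 2 2) // orbb dvdn_prime2 // => /eqP p2.
by move: p1; rewrite p2.
Qed.

Lemma pid_norm_unit a b c : Eis b -> Eis c -> b != 0 -> a = b * c ->
  norm_eis a = norm_eis b -> pid a = pid b.
Proof.
move=> Eb Ec b0 Ea nab; rewrite Ea pid_mul_unit //.
apply/eqP; rewrite -(eqn_pmul2l (norm_eis_gt0 Eb b0)) -norm_eisM //.
by rewrite -Ea nab muln1.
Qed.

Lemma split_dvd x : Eis x -> (p %| norm_eis x)%N ->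
  eis_dvd pi x \/ eis_dvd (pi^*)%C x.
Proof.
move=> Ex px.
have : eis_dvd pi (x * (x^*)%C).
  rewrite -norm_eis_mul_conj //; have /dvdnP[m ->] := px.
  rewrite natrM -n_pi norm_eis_mul_conj //; exists (m%:R * (pi^*)%C);
    last by ring.
  by apply: EisM; [apply: Eis_nat | apply: Eis_conj].
move/(eis_euclid_lemma Epi pi_pr Ex (Eis_conj Ex)) => [|/eis_dvd_conj];
  first by left.
by rewrite conjcK; right.
Qed.

Lemma split_norm_p x : Eis x -> norm_eis x = p ->
  pid x = pid pi \/ pid x = pid (pi^*)%C.
Proof.
move=> Ex nx; have [||[c Ec E]|[c Ec E]] := @split_dvd x => //.
- by rewrite nx.
- by left; apply: pid_norm_unit E _; rewrite ?nx.
- right; apply: pid_norm_unit E _; rewrite ?nx ?norm_eis_conj //.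
  exact: Eis_conj.
Qed.

Lemma pid_mul_eq a b c : Eis a -> Eis b -> Eis c -> pid b = pid c ->
  pid (a * b) = pid (a * c).
Proof. by move=> Ea Eb Ec E; rewrite -!ideal_mul_pid // E. Qed.

Lemma split_norm_p2 x : Eis x -> norm_eis x = (p ^ 2)%N ->
  [\/ pid x = pid (pi * pi), pid x = pid (pi * (pi^*)%C)
    | pid x = pid ((pi^*)%C * (pi^*)%C)].
Proof.
move=> Ex nx; have Epic := Eis_conj Epi.
have n_c a c : Eis a -> Eis c -> norm_eis a = p -> x = a * c -> norm_eis c = p.
  move=> Ea Ec na E; apply/eqP; rewrite -(eqn_pmul2l (prime_gt0 p_pr)).
  by rewrite -{1}na -norm_eisM // -E nx mulnn.
have [||[c Ec E]|[c Ec E]] := @split_dvd x => //.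
- by rewrite nx dvdn_mulr.
- have [Ec'|Ec'] := split_norm_p Ec (n_c _ _ Epi Ec n_pi E).
    by constructor 1; rewrite E; apply: pid_mul_eq.
  by constructor 2; rewrite E; apply: pid_mul_eq.
- have n_pic : norm_eis (pi^*)%C = p by rewrite norm_eis_conj.
  have [Ec'|Ec'] := split_norm_p Ec (n_c _ _ Epic Ec n_pic E).
    by constructor 2; rewrite E [pi * _]mulrC; apply: pid_mul_eq.
  by constructor 3; rewrite E; apply: pid_mul_eq.
Qed.

Lemma split_pid_neq : pid pi != pid (pi^*)%C.
Proof.
apply/eqP => /(pid_eq_dvd (Eis_conj Epi)); exact: split_not_dvd_conj.
Qed.

Lemma split_pid2_uniq :
  uniq [:: pid (pi * pi); pid (pi * (pi^*)%C); pid ((pi^*)%C * (pi^*)%C)].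
Proof.
have Epic := Eis_conj Epi.
rewrite /= !inE andbT negb_or -andbA; apply/and3P; split;
  apply/eqP => /pid_eq_dvd.
- move=> /(_ (EisM Epi Epic)) [c Ec E]; apply: split_not_dvd_conj.
  by exists c => //; apply: (mulfI pi0); rewrite mulrA.
- move=> /(_ (EisM Epic Epic)) [c Ec E]; apply: split_not_dvd_conj.
  apply: (@eis_dvdX pi _ 2) => //; exists (pi * c); first exact: EisM.
  by rewrite mulrA -E expr2.
- move=> /(_ (EisM Epic Epic)) [c Ec E]; apply: split_not_dvd_conj.
  by exists c => //; apply: (mulfI pic0); rewrite E; ring.
Qed.

End Split.

(** Pigeonhole on the coordinates of the powers of [a] modulo [N(l)], a multiple of [l]: two powers
    are congruent modulo [l], and the smaller one can be cancelled. *)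
Lemma eis_power_cong1 (a l : C) : Eis a -> Eis l -> l != 0 ->
  coprime_ideals K (pid a) (pid l) ->
  exists2 m, (0 < m)%N & eis_dvd l (a ^+ m - 1).
Proof.
move=> Ea El l0 /coprime_pid-/(_ Ea El)[u [v [Eu Ev E]]].
have cancel n w : Eis w -> eis_dvd l (a ^+ n * w) -> eis_dvd l w.
  move=> Ew; elim: n => [|n IHn]; first by rewrite mul1r.
  rewrite exprS -mulrA => -[d Ed Ed']; apply: IHn.
  exists (d * u + v * (a ^+ n * w)).
    by apply: EisD; apply: EisM => //; apply: EisM => //; apply: EisX.
  by rewrite -[LHS]mul1r -E mulrDr [l * (d * u)]mulrA -Ed'; ring.
pose N := norm_eis l; have N_gt0 : (0 < N)%N by apply: norm_eis_gt0.
have lN (x y : int) : (N %| x)%Z -> (N %| y)%Z -> eis_dvd l (eis R x y).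
  move=> /dvdzP[s ->] /dvdzP[t ->].
  exists ((l^*)%C * eis R s t).
    by apply: EisM; [apply: Eis_conj | apply: Eis_eis].
  by rewrite mulrA -norm_eis_mul_conj // -/N /eis !rmorphM /= -!pmulrn; ring.
have /choice[c Ec] : forall i, exists xy : int * int, a ^+ i = eis R xy.1 xy.2.
  by move=> i; have [x [y ->]] := EisX i Ea; exists (x, y).
pose r (x : int) : 'I_N.-1.+1 := inord (absz (x %% N)%Z).
have rP x y : r x = r y -> (N %| x - y)%Z.
  have lt (z : int) : (absz (z %% N)%Z < N.-1.+1)%N.
    have := @ltz_pmod z N; have := @modz_ge0 z N.
    by rewrite prednK //; move: (z %% N)%Z => w; lia.
  move/(congr1 val); rewrite /= !inordK // => H.
  rewrite -eqz_mod_dvd; apply/eqP.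
  have := @modz_ge0 x N; have := @modz_ge0 y N.
  by move: (x %% N)%Z (y %% N)%Z H => w w'; lia.
pose g (i : 'I_((N.-1.+1) ^ 2).+1) := (r (c i).1, r (c i).2).
have /injectivePn[i [j neq_ij]] : ~~ injectiveb g.
  by apply/injectiveP => /leq_card; rewrite card_prod !card_ord mulnn ltnn.
wlog lt_ij : i j neq_ij / (i < j)%N.
  move=> W; have [lt|lt|/val_inj eq] := ltngtP i j; first exact: W.
    by move=> eq; apply: (W j i) => //; rewrite eq_sym.
  by rewrite eq eqxx in neq_ij.
case=> /esym/rP r1 /esym/rP r2; exists (j - i)%N; first by rewrite subn_gt0.
have dv : eis_dvd l (a ^+ i * (a ^+ (j - i) - 1)).
  rewrite mulrBr mulr1 -exprD subnKC ?(ltnW lt_ij) // !Ec eisN eisD.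
  exact: lN.
apply: (cancel i) dv.
by apply: EisB; [apply: EisX | apply: Eis1].
Qed.

End EisensteinPrimes.

(** * Coefficients of forms with complex multiplication *)

Section HeckeRecurrence.
Variables (F : fieldType) (k : nat) (A : nat -> F).
Hypothesis A1 : A 1%N = 1.
Hypothesis hecke : forall p n, prime p -> p != 3%N -> (0 < n)%N ->
  A (p * n)%N + (if (p %| n)%N then p%:R ^+ k.-1 * A (n %/ p)%N else 0) =
    A p * A n.

Lemma hecke_pow p m e : prime p -> p != 3%N -> (0 < m)%N -> ~~ (p %| m)%N ->
  A (p ^ e.+2 * m)%N =
    A p * A (p ^ e.+1 * m)%N - p%:R ^+ k.-1 * A (p ^ e * m)%N.
Proof.
move=> p_pr p3 m_gt0 pm; have p_gt0 := prime_gt0 p_pr.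
have := @hecke p (p ^ e.+1 * m) p_pr p3.
rewrite muln_gt0 expn_gt0 p_gt0 m_gt0 => /(_ isT) <-.
have -> : ((p ^ e.+1 * m) %/ p = p ^ e * m)%N by rewrite expnS -mulnA mulKn.
by rewrite dvdn_mulr ?dvdn_exp // addrK mulnA -expnS.
Qed.

Lemma hecke_mul p m e : prime p -> p != 3%N -> (0 < m)%N -> ~~ (p %| m)%N ->
  A (p ^ e * m)%N = A (p ^ e)%N * A m.
Proof.
move=> p_pr p3 m_gt0 pm; have p_gt0 := prime_gt0 p_pr.
have p1 : ~~ (p %| 1)%N by rewrite dvdn1 neq_ltn prime_gt1 // orbT.
elim/ltn_ind: e => -[|[|e]] IHe; first by rewrite expn0 mul1n A1 mul1r.
  by have := hecke p_pr p3 m_gt0; rewrite (negPf pm) addr0 expn1.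
rewrite hecke_pow // !IHe //.
have := @hecke_pow p 1 e p_pr p3 isT p1; rewrite !muln1 => ->; ring.
Qed.

Lemma hecke_pow_inert p e : prime p -> p != 3%N -> A p = 0 ->
  A (p ^ e)%N = if odd e then 0 else (- p%:R ^+ k.-1) ^+ e./2.
Proof.
move=> p_pr p3 Ap0; have p1 : ~~ (p %| 1)%N
  by rewrite dvdn1 neq_ltn prime_gt1 // orbT.
elim/ltn_ind: e => -[|[|e]] IHe; rewrite ?expn0 ?expn1 //.
have := @hecke_pow p 1 e p_pr p3 isT p1; rewrite !muln1 => ->.
rewrite Ap0 mul0r sub0r IHe //= negbK; case: (odd e);
  first by rewrite mulr0 oppr0.
by rewrite exprS mulNr.
Qed.

(** [x] and [y] are the roots of the Hecke polynomial [T^2 - A(p) T + p^(k-1)]. Multiplying by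
    [x - y] avoids a division and covers [x = y]. *)
Lemma hecke_pow_split p e x y : prime p -> p != 3%N ->
  A p = x + y -> p%:R ^+ k.-1 = x * y ->
  (x - y) * A (p ^ e)%N = x ^+ e.+1 - y ^+ e.+1.
Proof.
move=> p_pr p3 Ap pk; have p1 : ~~ (p %| 1)%N
  by rewrite dvdn1 neq_ltn prime_gt1 // orbT.
elim/ltn_ind: e => -[|[|e]] IHe; first by rewrite expn0 A1 mulr1.
  by rewrite expn1 Ap; ring.
have := @hecke_pow p 1 e p_pr p3 isT p1; rewrite !muln1 => ->.
rewrite mulrBr mulrCA (IHe e.+1) // mulrCA (IHe e) // Ap pk !exprS; ring.
Qed.

End HeckeRecurrence.

(** * Coefficients as sums of a Hecke character *)

Section CM.
Variable R : realType.
Local Notation C := R[i].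
Local Notation Eis := (@Eis R).
Local Notation K := (@imag_quad_field R 3).
Local Notation pid := (principal_ideal K).
Variables (k : nat) (A : nat -> C) (l : C) (phi : set C -> C).
Hypotheses (k_gt0 : (0 < k)%N) (k_even : ~~ odd k).
Hypotheses (El : Eis l) (l0 : l != 0).
Hypothesis phiP : is_hecke_character K k (pid l) phi.
Hypothesis A_sum : forall n, (0 < n)%N ->
  A n = \sum_(I \in [set I | [/\ is_integral_ideal K I,
                   coprime_ideals K I (pid l) & has_ideal_norm K I n]]) phi I.
Hypothesis hecke : forall p n, prime p -> p != 3%N -> (0 < n)%N ->
  A (p * n)%N + (if (p %| n)%N then p%:R ^+ k.-1 * A (n %/ p)%N else 0) =
    A p * A n.

Hypothesis A1 : A 1%N = 1.

Definition prime_to (a : C) : Prop := coprime_ideals K (pid a) (pid l).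

(** The Hecke character as a function of generators, extended by zero like a Dirichlet character,
    since [phi] is arbitrary on ideals not prime to the modulus. *)
Definition chi (a : C) : C := if `[< prime_to a >] then phi (pid a) else 0.

Lemma prime_toP a : Eis a ->
  prime_to a <-> exists u v, [/\ Eis u, Eis v & a * u + l * v = 1].
Proof. by move=> Ea; apply: coprime_pid. Qed.

Lemma prime_toM a b : Eis a -> Eis b ->
  prime_to (a * b) <-> prime_to a /\ prime_to b.
Proof.
move=> Ea Eb; rewrite !prime_toP //; last exact: EisM.
split=> [[u [v [Eu Ev E]]]|[[u [v [Eu Ev E]]] [u' [v' [Eu' Ev' E']]]]].
  split; [exists (b * u), v|exists (a * u), v]; split=> //; try exact: EisM;
  by rewrite -E; ring.
exists (u * u'), (v + a * u * v'); split.
- exact: EisM.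
- by apply: EisD => //; apply: EisM => //; apply: EisM.
- transitivity (a * u * (b * u' + l * v') + l * v); first by ring.
  by rewrite E' mulr1 E.
Qed.

Lemma prime_to1 : prime_to 1.
Proof. exact: coprime_eis_ideal1. Qed.

Lemma chiM a b : Eis a -> Eis b -> a != 0 -> b != 0 ->
  chi (a * b) = chi a * chi b.
Proof.
move=> Ea Eb a0 b0; rewrite /chi.
case: (asboolP (prime_to a)) => [pa|npa]; last first.
  by rewrite mul0r asboolF // => /(prime_toM Ea Eb)[].
case: (asboolP (prime_to b)) => [pb|npb]; last first.
  by rewrite mulr0 asboolF // => /(prime_toM Ea Eb)[].
rewrite asboolT; last exact/prime_toM.
case: phiP => _ phiM _.
by rewrite -phiM ?ideal_mul_pid //; apply: pid_prime_to.
Qed.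

Lemma chi_neq0 a : Eis a -> a != 0 -> prime_to a -> chi a != 0.
Proof.
move=> Ea a0 pa; rewrite /chi asboolT //.
by case: phiP => phi0 _ _; apply/phi0/pid_prime_to.
Qed.

Lemma chi1 : chi 1 = 1.
Proof.
have c1 : chi 1 != 0.
  by apply: chi_neq0; [apply: Eis1|apply: oner_neq0|apply: prime_to1].
apply: (mulfI c1); rewrite -chiM ?mulr1 ?oner_neq0 //; exact: Eis1.
Qed.

Lemma chi_eq a b : pid a = pid b -> chi a = chi b.
Proof. by move=> E; rewrite /chi /prime_to E. Qed.

Lemma chiX a n : Eis a -> a != 0 -> chi (a ^+ n) = chi a ^+ n.
Proof.
move=> Ea a0; elim: n => [|n IHn]; first exact: chi1.
by rewrite !exprS chiM ?IHn ?expf_neq0 //; apply: EisX.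
Qed.

Lemma Eis_integers a : Eis a -> ring_of_integers K a.
Proof. by rewrite integers_eis. Qed.

Lemma chi_cong1 a : Eis a -> a != 0 -> eis_dvd l (a - 1) -> chi a = a ^+ k.-1.
Proof.
move=> Ea a0 dv.
have pa : prime_to a.
  apply/prime_toP => //; have [c Ec E] := dv; exists 1, (- c).
  by split; [apply: Eis1 | apply: EisN | rewrite mulr1 mulrN -E; ring].
rewrite /chi asboolT //; case: phiP => _ _ -> //; first exact: Eis_K.
exists a, 1; split; rewrite ?oner_neq0 ?divr1 //; try exact: Eis_integers.
- exact: Eis_integers (Eis1 R).
- exact: coprime_eis_ideal1.
- by split=> //; apply/pidP.
Qed.

(** Some power of [a] is 1 modulo [l], and there [chi] is prescribed. *)
Lemma chi_pow a : Eis a -> a != 0 -> prime_to a ->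
  exists2 m, (0 < m)%N & chi a ^+ m = a ^+ (m * k.-1).
Proof.
move=> Ea a0 pa; have [m m_gt0 dv] := eis_power_cong1 Ea El l0 pa.
exists m => //; rewrite -chiX // chi_cong1 ?exprM //; first exact: EisX.
by rewrite expf_neq0.
Qed.

(* [-1] is congruent to [1] modulo the unit ideal, but [(-1)^(k-1) = -1]. *)
Lemma modulus_not_unit : norm_eis l <> 1%N.
Proof.
move=> nl.
have E1 : Eis (-1) by apply: EisN; apply: Eis1.
have c1 : chi (-1) = 1.
  rewrite -[RHS]chi1; apply: chi_eq; rewrite -[-1]mul1r pid_mul_unit //.
    exact: Eis1.
  by have := norm_eisE R (-1) 0; rewrite /nm /eis mul0r addr0 => -[].
have : chi (-1) = (-1) ^+ k.-1.
  apply: chi_cong1; rewrite ?oppr_eq0 ?oner_neq0 //.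
  exists ((l^*)%C * (-1 - 1)).
    by apply: EisM; [apply: Eis_conj | apply: EisB => //; apply: Eis1].
  by rewrite mulrA eis_unit // mul1r.
rewrite c1 -signr_odd; have -> : odd k.-1.
  by case: (k) k_gt0 k_even => //= n _; rewrite negbK.
by move/eqP; rewrite expr1 -subr_eq0 opprK -(natrD _ 1 1) pnatr_eq0.
Qed.

(** The list [s] may contain generators not prime to [l], where [chi] is zero; so [A n] can be
    computed before the prime factors of [l] are known. *)
Lemma coef_sum (n : nat) (s : seq C) : (0 < n)%N ->
  uniq [seq pid a | a <- s] ->
  (forall a, a \in s -> Eis a /\ norm_eis a = n) ->
  (forall a, Eis a -> norm_eis a = n -> prime_to a ->
     exists2 b, b \in s & pid a = pid b) ->
  A n = \sum_(a <- s) chi a.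
Proof.
move=> n_gt0 s_uniq s_norm s_all; rewrite A_sum //.
set S := [set I | _].
have SP a : Eis a -> S (pid a) <-> [/\ a != 0, prime_to a & norm_eis a = n].
  move=> Ea; split=> [[Ia Ca Na]|[a0 pa na]].
    have a0 : a != 0.
      apply/eqP => a0; case: Ia => -[_ _ _ [x /pidP[c _ Ex] x0] _] _.
      by rewrite Ex a0 mul0r eqxx in x0.
    by split=> //; move/(pid_norm n Ea a0): Na.
  by split; [apply: pid_integral | | apply/pid_norm].
pose g (I : set C) : C :=
  if `[< coprime_ideals K I (pid l) >] then phi I else 0.
transitivity (\sum_(I \in S) g I).
  by apply: eq_fsbigr => I; rewrite inE => -[_ cI _]; rewrite /g asboolT.
transitivity (\sum_(I \in [set` [seq pid a | a <- s]]) g I).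
  apply: fsbig_widen.
    move=> I SI; have [II _ _] := SI.
    have [a [Ea a0] EI] := integral_ideal_pid II.
    move: SI; rewrite EI => /(SP _ Ea)[_ pa na].
    by have [b sb ->] := s_all a Ea na pa; apply/mapP; exists b.
  move=> I [/= /mapP[a sa ->] nS]; rewrite /= /g asboolF // => ca; apply: nS.
  have [Ea na] := s_norm a sa; apply/SP => //; split=> //.
  by apply: eis_neq0 na _.
by rewrite -fsbig_seq // big_map.
Qed.

Lemma coef_inert p : prime p -> (p %% 3 = 2)%N -> A p = 0.
Proof.
move=> p_pr p2; rewrite (@coef_sum p [::]) ?big_nil ?prime_gt0 //.
move=> a Ea na _; have [|c Ec E] := eis_dvd_inert p_pr p2 Ea;
  first by rewrite na.
move: na; rewrite E norm_eisM //; last exact: Eis_nat.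
rewrite norm_eis_nat -mulnn; have := prime_gt1 p_pr.
by case: (norm_eis c) => [|m] ? ?; nia.
Qed.

(** The only ideal of norm [p^2] is generated by [p], so [A(p^2) = chi p], while the Hecke relation
    and [A p = 0] give [A(p^2) = - p^(k-1)], which is not zero. *)
Lemma inert_prime_to p : prime p -> (p %% 3 = 2)%N -> prime_to p%:R.
Proof.
move=> p_pr p2; have p_gt0 := prime_gt0 p_pr.
have p3 : p != 3%N by apply/eqP => p3; move: p2; rewrite p3.
have p0 : p%:R != 0 :> C by rewrite pnatr_eq0 -lt0n.
have A2 : A (p ^ 2)%N = chi p%:R.
  rewrite (@coef_sum (p ^ 2) [:: p%:R]) ?big_seq1 ?expn_gt0 ?p_gt0 //.
    move=> a; rewrite inE => /eqP ->; rewrite norm_eis_nat; split=> //;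
      exact: Eis_nat.
  move=> a Ea na _; exists p%:R; first by rewrite inE.
  have [|c Ec E] := eis_dvd_inert p_pr p2 Ea; first by rewrite na dvdn_mulr.
  apply: pid_norm_unit E _ => //; first exact: Eis_nat.
  by rewrite na norm_eis_nat.
have := hecke_pow_inert A1 hecke 2 p_pr p3 (coef_inert p_pr p2).
rewrite A2 /= expr1 /chi; case: asboolP => // _ /eqP.
by rewrite eq_sym oppr_eq0 expf_eq0 (negPf p0) andbF.
Qed.

Lemma prime_to_dvd a x : Eis a -> prime_to a ->
  eis_dvd x a -> eis_dvd x l -> Eis x -> norm_eis x = 1%N.
Proof.
move=> Ea /(prime_toP Ea)[u [v [Eu Ev E]]] xa xl Ex; apply: eis_dvd1 => //.
by rewrite -E; apply: eis_dvdD; apply: eis_dvd_mul.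
Qed.

Lemma eis_dvd_refl (a : C) : eis_dvd a a.
Proof. by exists 1; rewrite ?mulr1 //; apply: Eis1. Qed.

Section SplitCoef.
Variables (p : nat) (pi : C).
Hypotheses (p_pr : prime p) (p1 : (p %% 3 = 1)%N).
Hypotheses (Epi : Eis pi) (n_pi : norm_eis pi = p).

Let Epic : Eis (pi^*)%C. Proof. exact: Eis_conj. Qed.
Let n_pic : norm_eis (pi^*)%C = p. Proof. by rewrite norm_eis_conj. Qed.
Let p_gt0 : (0 < p)%N. Proof. exact: prime_gt0. Qed.
Let pi0 : pi != 0. Proof. exact: eis_neq0 n_pi p_gt0. Qed.
Let pic0 : (pi^*)%C != 0. Proof. by rewrite conjc_eq0. Qed.
Let p3 : p != 3%N. Proof. by apply/eqP => p3; move: p1; rewrite p3. Qed.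

Lemma coef_split : A p = chi pi + chi (pi^*)%C.
Proof.
rewrite (@coef_sum p [:: pi; (pi^*)%C]) ?big_cons ?big_nil ?addr0 //=.
- by rewrite inE andbT (split_pid_neq p_pr p1 Epi n_pi).
- by move=> a; rewrite !inE => /orP[]/eqP ->.
- move=> a Ea na _.
  have [E|E] := split_norm_p p_pr Epi n_pi Ea na.
    by exists pi; rewrite ?inE ?eqxx.
  by exists (pi^*)%C; rewrite ?inE ?eqxx ?orbT.
Qed.

Lemma coef_split2 :
  A (p ^ 2)%N = chi pi ^+ 2 + chi pi * chi (pi^*)%C + chi (pi^*)%C ^+ 2.
Proof.
rewrite (@coef_sum (p ^ 2) [:: pi * pi; pi * (pi^*)%C; (pi^*)%C * (pi^*)%C]);
  rewrite ?expn_gt0 ?p_gt0 //.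
- by rewrite !big_cons big_nil addr0 !chiM // addrA !expr2.
- exact: (split_pid2_uniq p_pr p1 Epi n_pi).
- by move=> a; rewrite !inE => /or3P[]/eqP ->;
  rewrite norm_eisM ?n_pi ?n_pic ?mulnn //;
    split=> //; apply: EisM.
- move=> a Ea na _.
  have [E|E|E] := split_norm_p2 p_pr Epi n_pi Ea na; eexists; try exact: E;
    by rewrite !inE eqxx ?orbT.
Qed.

(* The Hecke relation [A(p^2) + p^(k-1) = A(p)^2] forces both primes above [p]
   to be prime to the modulus. *)
Lemma chi_split_mul : p%:R ^+ k.-1 = chi pi * chi (pi^*)%C.
Proof.
have := hecke p_pr p3 p_gt0; rewrite dvdnn divnn p_gt0 A1 mulr1 mulnn.
rewrite coef_split2 coef_split => E.
apply: (addrI (chi pi ^+ 2 + chi pi * chi (pi^*)%C + chi (pi^*)%C ^+ 2)).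
by rewrite E; ring.
Qed.

Lemma split_prime_to : prime_to pi /\ prime_to (pi^*)%C.
Proof.
have : chi pi * chi (pi^*)%C != 0.
  by rewrite -chi_split_mul expf_neq0 // pnatr_eq0 -lt0n.
rewrite /chi; do 2!case: asboolP; rewrite ?mulr0 ?mul0r ?eqxx //.
Qed.

(* If [A(p^e) = 0] then [chi pi] and [chi pi^*] have the same [(e+1)]-th power,
   hence so do, up to a further power, [pi] and [pi^*] themselves; but these are
   not associate. *)
Lemma coef_split_neq0 e : A (p ^ e)%N != 0.
Proof.
apply/eqP => A0.
have := hecke_pow_split A1 hecke e p_pr p3 coef_split chi_split_mul.
rewrite A0 mulr0 => /esym/eqP; rewrite subr_eq0 => /eqP E.
have [pa pb] := split_prime_to.
have [m m_gt0 Em] := chi_pow Epi pi0 pa.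
have [m' m'_gt0 Em'] := chi_pow Epic pic0 pb.
have {}E : pi ^+ (m * k.-1 * m' * e.+1) = (pi^*)%C ^+ (m' * k.-1 * m * e.+1).
  transitivity ((chi pi ^+ e.+1) ^+ (m * m')).
    rewrite [LHS]exprM [X in X ^+ _ = _]exprM -Em -!exprM.
    by congr (_ ^+ _); lia.
  rewrite E [RHS]exprM [X in _ = X ^+ _]exprM -Em' -!exprM.
  by congr (_ ^+ _); lia.
apply: (split_not_dvd_conj p_pr p1 Epi n_pi).
apply: (@eis_dvdX R pi _ (m' * k.-1 * m * e.+1)); rewrite ?n_pi //.
rewrite -E; have : (0 < m * k.-1 * m' * e.+1)%N.
  rewrite !muln_gt0 m_gt0 m'_gt0 !andbT.
  (* An even positive [k] is at least 2, so [k - 1] is positive. *)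
  by case: (k) k_gt0 k_even => [|[|]].
case: (_ * _)%N => // n _; rewrite exprS.
by apply: eis_dvd_mul; [apply: EisX | apply: eis_dvd_refl].
Qed.

End SplitCoef.

Lemma split_eis p : prime p -> (p %% 3 = 1)%N ->
  exists2 pi, Eis pi & norm_eis pi = p.
Proof.
move=> p_pr /(nm_split p_pr)[a [b E]]; exists (eis R a b); first exact: Eis_eis.
by apply/eqP; rewrite -eqz_nat norm_eisE E.
Qed.

(* All primes of norm prime to 3 being prime to the modulus [l], a non-unit [l]
   can only be divisible by [sqrtN3]. *)
Lemma sqrtN3_dvd_modulus : eis_dvd (sqrtN3 R) l.
Proof.
apply: sqrtN3_dvd => //.
have nl_gt0 := norm_eis_gt0 El l0.
have nl_neq1 : norm_eis l != 1%N by apply/eqP; apply: modulus_not_unit.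
pose p := pdiv (norm_eis l).
have p_pr : prime p by apply: pdiv_prime; lia.
have p_dv : (p %| norm_eis l)%N by apply: pdiv_dvd.
have [p2|p2] := eqVneq (p %% 3)%N 2%N.
  have := prime_to_dvd (Eis_nat R p) (inert_prime_to p_pr p2) (eis_dvd_refl _)
    (eis_dvd_inert p_pr p2 El p_dv) (Eis_nat R p).
  by rewrite norm_eis_nat -mulnn => pp; have := prime_gt1 p_pr; nia.
have [p1|p1] := eqVneq (p %% 3)%N 1%N.
  have [pi Epi n_pi] := split_eis p_pr p1.
  have [pa pb] := split_prime_to p_pr p1 Epi n_pi.
  have := p_pr; have [dv|dv] := split_dvd p_pr Epi n_pi El p_dv.
    by rewrite -n_pi (prime_to_dvd Epi pa (eis_dvd_refl _) dv Epi).
  have Epic := Eis_conj Epi.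
  by rewrite -n_pi -norm_eis_conj //
    (prime_to_dvd Epic pb (eis_dvd_refl _) dv Epic).
suff <- : p = 3%N by [].
by apply/esym/eqP; rewrite -dvdn_prime2 // /dvdn; lia.
Qed.

(** An element of norm divisible by 3 shares the factor [sqrtN3] with [l], so the sum for [A n] is
    empty. *)
Lemma coef_dvd3 n : (0 < n)%N -> (3 %| n)%N -> A n = 0.
Proof.
move=> n_gt0 n3; rewrite (@coef_sum n [::]) ?big_nil // => a Ea na pa.
have := prime_to_dvd Ea pa (sqrtN3_dvd Ea _) sqrtN3_dvd_modulus (Eis_sqrtN3 R).
by rewrite norm_sqrtN3 na => /(_ n3).
Qed.

(** By [hecke_mul], for [n] prime to 3, [A n] is a product of values at prime powers; those of inert
    primes vanish exactly at odd exponents, those of split primes never. *)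
Lemma coef_neq0 n : (0 < n)%N ->
  A n != 0 <-> ~~ (3 %| n)%N /\
     forall p, prime p -> (p %% 3 = 2)%N -> ~~ odd (logn p n).
Proof.
move=> n_gt0; split=> [An|[]].
  split=> [|p p_pr p2]; first by apply: contra An => /(coef_dvd3 n_gt0) ->.
  apply: contra An => odd_n;
  have p3 : p != 3%N by apply/eqP => p3; move: p2; rewrite p3.
  have [m pm En] := pfactor_coprime p_pr n_gt0.
  have m_gt0 : (0 < m)%N by move: n_gt0; rewrite En muln_gt0 => /andP[].
  rewrite En mulnC (hecke_mul A1 hecke) //; last by rewrite -prime_coprime.
  by rewrite (hecke_pow_inert A1 hecke) // ?odd_n ?mul0r //; apply: coef_inert.
elim/ltn_ind: n n_gt0 => n IHn n_gt0 n3 n_even.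
have [->|n_neq1] := eqVneq n 1%N; first by rewrite A1 oner_neq0.
have p_pr : prime (pdiv n) by apply: pdiv_prime; lia.
have := pdiv_dvd n; move: (pdiv n) p_pr => p p_pr pn.
have p3 : p != 3%N by apply/eqP => p3; move: n3; rewrite -p3 pn.
have [m pm En] := pfactor_coprime p_pr n_gt0.
have e_gt0 : (0 < logn p n)%N by rewrite logn_gt0 mem_primes p_pr n_gt0.
have m_gt0 : (0 < m)%N by move: n_gt0; rewrite En muln_gt0 => /andP[].
rewrite En mulnC (hecke_mul A1 hecke) //; last by rewrite -prime_coprime.
rewrite mulf_neq0 //.
  have [p2|p2] := eqVneq (p %% 3)%N 2%N.
    rewrite (hecke_pow_inert A1 hecke) // ?(negPf (n_even p p_pr p2));
      last exact: coef_inert.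
    by rewrite expf_neq0 // oppr_eq0 expf_neq0 // pnatr_eq0 -lt0n prime_gt0.
  have p1 : (p %% 3 = 1)%N.
    have : ~~ (3 %| p)%N by rewrite dvdn_prime2 // eq_sym.
    by rewrite /dvdn; lia.
  have [pi Epi n_pi] := split_eis p_pr p1.
  exact: coef_split_neq0 n_pi _.
apply: IHn => //.
- rewrite [X in (_ < X)%N]En ltn_Pmulr // -[1%N](expn0 p) ltn_exp2l //
  prime_gt1 //.
- by apply: contra n3; rewrite En => /dvdn_mulr ->.
move=> q q_pr q2; have := n_even q q_pr q2.
have -> : logn q n = (logn q m + logn q (p ^ logn p n))%N.
  by rewrite {1}En lognM // expn_gt0 prime_gt0.
rewrite oddD.
have [->|qp] := eqVneq q p;
  last by rewrite lognX (logn_prime _ p_pr) (negPf qp) muln0 addbF.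
by rewrite (logn_coprime pm).
Qed.

End CM.

(** * Comparison of the two vanishing conditions *)

Lemma core3_star_neq0_prime (n : nat) : (0 < n)%N ->
  core3_star n != 0 <-> ~~ (3 %| n)%N /\
    forall p, prime p -> (p %% 3 = 2)%N -> ~~ odd (logn p n).
Proof.
move=> n_gt0; split=> [/core3_star_neq0[n1 /(eisenstein_normP n_gt0) even_n]|].
  by split=> //; rewrite /dvdn n1.
move=> [n3 /(eisenstein_normP n_gt0) nm_n]; apply/core3_star_neq0; split=> //.
have [a [b E]] := nm_n.
(* A norm is a square modulo 3, so it is 1 modulo 3 as soon as 3 does not divide it. *)
have : n%:Z + 3 * (a * b) = (a + b) ^+ 2 by rewrite -E /nm; ring.
have [t [r [Et r3]]] : exists t r : int,
  a + b = 3 * t + r /\ (r = 0 \/ r = 1 \/ r = 2).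
  exists ((a + b) %/ 3)%Z, ((a + b) %% 3)%Z; split;
    first by rewrite mulrC -divz_eq.
  have := @ltz_pmod (a + b) 3 isT; have := @modz_ge0 (a + b) 3 isT.
  by move: (_ %% _)%Z => r; lia.
by rewrite Et; move: n3; rewrite /dvdn; case: r3 => [->|[->|->]]; lia.
Qed.

Theorem theorem1p1 (R : realType) (k s : nat) (f : R[i] -> R[i])
    (A : nat -> R[i])
    (k_gt0 : (0 < k)%N) (k_even : ~~ odd k) (s_ge2 : (2 <= s)%N)
    (f_newform : is_newform (3 ^ s)%N k f A)
    (f_CM : has_CM (imag_quad_field 3) k A) :
  (forall n : nat, (0 < n)%N -> (A n = 0 <-> core3_star n = 0)) /\
  (forall n : nat, (0 < n)%N ->
     (exists p : nat, [/\ prime p, (p %% 3 = 2)%N & odd (logn p n)]) ->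
     A n = 0 /\ core3_star n = 0).
Proof.
case: f_newform => _ _ eig expA A1.
have hecke p n : prime p -> p != 3%N -> (0 < n)%N ->
    A (p * n)%N + (if (p %| n)%N then p%:R ^+ k.-1 * A (n %/ p)%N else 0) =
      A p * A n.
  move=> p_pr p3; have [|lam eig_p] := eig p p_pr.
    by rewrite Euclid_dvdX // dvdn_prime2 // (negPf p3).
  have rel := hecke_coef p_pr expA eig_p.
  (* The normalization [A 1 = 1] identifies the eigenvalue: it is the relation at [n = 1]. *)
  have <- : lam = A p.
    have := rel 1%N isT; rewrite muln1 A1 mulr1 dvdn1.
    by rewrite (gtn_eqF (prime_gt1 p_pr)) addr0.
  exact: rel.
have [L [phi [L_int phiP A_sum]]] := f_CM.
have [l [El l0] EL] := integral_ideal_pid L_int.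
rewrite {}EL in phiP A_sum.
have A_neq0 n n_gt0 :=
  coef_neq0 k_gt0 k_even El l0 phiP A_sum hecke A1 (n := n) n_gt0.
have eq0 n : (0 < n)%N -> (A n = 0 <-> core3_star n = 0).
  move=> n_gt0; have [An cn] := (A_neq0 n n_gt0, core3_star_neq0_prime n_gt0).
  by split=> /eqP H; apply/eqP; apply: contraTT H => ?;
    [apply/An/cn | apply/cn/An].
split=> // n n_gt0 [p [p_pr p2 odd_n]].
suff A0 : A n = 0 by split=> //; apply/eq0.
apply/eqP; apply: contraTT odd_n => /(A_neq0 n n_gt0)[_]; exact.
Qed.
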